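(* Let $\Bbbk$ be an algebraically closed field of characteristic $p>3$ and let $c\in\mathbb{F}_p$ with $p/2<c<2p/3$. The irreducible representation $L_{1,c}(\mathrm{Triv})$ of $H_{1,c}(S_3,\mathfrak{h})$ is the quotient of the Verma module $M_{1,c}(\mathrm{Triv})$ by the submodule generated by the vectors $$v_{6c-3p}=q^{2c-p}=(-4\sigma_2^3-27\sigma_3^2)^{c-\frac{p+1}{2}}q,$$ $$v_p=\sigma_2^{2p-3c}\sigma_3\sum_{j=0}^{c-\frac{p+1}{2}}\binom{c-\frac{p+1}{2}}{j}\frac{1}{2j+1}(-4\sigma_2^3)^{c-\frac{p+1}{2}-j}(-27\sigma_3^2)^j.$$ This quotient is a complete intersection, and its character and Hilbert polynomial are $$\chi_{L_{1,c}(\mathrm{Triv})}(z)=\chi_{S\mathfrak{h}^*}(z)\left(1-z^{6c-3p}[\mathrm{Sign}]-z^p[\mathrm{Triv}]+z^{6c-2p}[\mathrm{Sign}]\right),\qquad h_{L_{1,c}(\mathrm{Triv})}(z)=\frac{(1-z^{6c-3p})(1-z^p)}{(1-z)^2}.$$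
   Context: $S_3$ acts on $V=\mathrm{span}_{\Bbbk}(y_1,y_2,y_3)$ by permuting the basis; $V^*$ has dual basis $x_1,x_2,x_3$. $\mathfrak{h}=\{\sum a_iy_i:\sum a_i=0\}\subset V$ and $\mathfrak{h}^*=V^*/\Bbbk(x_1+x_2+x_3)$, spanned by the images $\overline{x_i}$ of $x_i$, with $\overline{x_1}+\overline{x_2}+\overline{x_3}=0$; $\langle\cdot,\cdot\rangle$ is the evaluation pairing. For $t,c\in\Bbbk$ the rational Cherednik algebra $H_{t,c}(S_3,\mathfrak{h})$ is the quotient of $\Bbbk[S_3]\ltimes T(\mathfrak{h}\oplus\mathfrak{h}^* )$ by the relations $[x,x']=0$, $[y,y']=0$, $[y,x]=t\langle x,y\rangle-\sum_{i<j}c\langle x-(ij).x,y\rangle(ij)$ for $x,x'\in\mathfrak{h}^*$, $y,y'\in\mathfrak{h}$; it is graded by $\deg x=1$, $\deg y=-1$, $\deg g=0$. For an irreducible $S_3$-representation $\tau$ (with $\mathfrak{h}$ acting by $0$) the Verma module is $M_{t,c}(\tau)=H_{t,c}(S_3,\mathfrak{h})\otimes_{\Bbbk[S_3]\ltimes S\mathfrak{h}}\tau\cong S\mathfrak{h}^*\otimes\tau$, graded with $\tau$ in degree $0$; $S_3$ acts diagonally, $x\in\mathfrak{h}^*$ by multiplication, and $y\in\mathfrak{h}$ by $D_y=t\partial_y\otimes\mathrm{id}-\sum_{i<j}c\langle x_i-x_j,y\rangle\frac{1-(ij)}{x_i-x_j}\otimes(ij)$. It has a maximal proper graded submodule $J_{t,c}(\tau)$,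 and $L_{t,c}(\tau)=M_{t,c}(\tau)/J_{t,c}(\tau)$ is irreducible and finite dimensional. For a graded $S_3$-representation $M=\oplus_kM^k$, the Hilbert series is $h_M(z)=\sum_k\dim M^kz^k$ and the character is $\chi_M(z)=\sum_k[M^k]z^k$ with coefficients in the Grothendieck ring $K_0(S_3)$ (product given by $\otimes$, unit $1=[\mathrm{Triv}]$). $M_{1,c}(\mathrm{Triv})$ is identified with $S\mathfrak{h}^*$. $\sigma_2=\overline{x_1}\,\overline{x_2}+\overline{x_1}\,\overline{x_3}+\overline{x_2}\,\overline{x_3}$, $\sigma_3=\overline{x_1}\,\overline{x_2}\,\overline{x_3}$, $q=(\overline{x_1}-\overline{x_2})(\overline{x_2}-\overline{x_3})(\overline{x_1}-\overline{x_3})$; these satisfy $q^2=-4\sigma_2^3-27\sigma_3^2$. For $p>3$ the irreducible $S_3$-representations are $\mathrm{Triv},\mathrm{Sign},\mathrm{Stand}\cong\mathfrak{h}^*$, and $\chi_{S\mathfrak{h}^*}(z)=\frac{1}{(1-z^2)(1-z^3)}\left([\mathrm{Triv}]+(z+z^2)[\mathrm{Stand}]+z^3[\mathrm{Sign}]\right)$. $c\in\mathbb{F}_p\subset\Bbbk$ is identified with an integer in $\{0,\dots,p-1\}$ in inequalities and exponents. *)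

(* Defs.v *)
From HB Require Import structures.
From mathcomp Require Import all_boot all_order all_algebra all_fingroup.
From mathcomp Require Import mxrepresentation character.
From mathcomp Require Import ssrcomplements mpoly.
From Stdlib Require Import Classical ClassicalEpsilon FunctionalExtensionality.
From mathcomp Require Import ring.

Set Implicit Arguments.
Unset Strict Implicit.
Unset Printing Implicit Defensive.

Import GRing.Theory.
Local Open Scope ring_scope.

Section Reflection.
Variable k : fieldType.
Implicit Types (a x y z : 'rV[k]_3) (s g : 'S_3).

(* A row y stands for \sum_i y 0 i * y_i in V and a row x for
   \sum_i x 0 i * x_i in V^*; elements of h^* = V^* / k(x_1 + x_2 + x_3) are
   given by representatives in V^*, on which the pairing with h is
   well defined. *)
Definition pairing x y : k := \sum_(i < 3) x 0 i * y 0 i.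

Definition in_h y : Prop := \sum_(i < 3) y 0 i = 0.

Definition basis3 (i : 'I_3) : 'rV[k]_3 := delta_mx 0 i.

(* g . y_i = y_(g i), so the j-th coordinate of g . y is that of y at g^-1 j. *)
Definition permv g (a : 'rV[k]_3) : 'rV[k]_3 := col_perm g^-1%g a.

(* An H_{t,c}(S_3, h)-module: an action of the generators of the algebra
   satisfying its defining relations.  Permutations compose from left to right
   in MathComp, hence the order in [ch_gM]. *)
Record cherednik_module (t c : k) := CherednikModule {
  ch_sort :> lmodType k;
  ch_g : 'S_3 -> ch_sort -> ch_sort;
  ch_x : 'rV[k]_3 -> ch_sort -> ch_sort;
  ch_y : 'rV[k]_3 -> ch_sort -> ch_sort;
  ch_g_linear : forall g, linear (ch_g g);
  ch_x_linear : forall x, linear (ch_x x);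
  ch_y_linear : forall y, in_h y -> linear (ch_y y);
  ch_xD : forall b x x' v, ch_x (b *: x + x') v = b *: ch_x x v + ch_x x' v;
  ch_x0 : forall v, ch_x (const_mx 1) v = 0;
  ch_yD : forall b y y' v, in_h y -> in_h y' ->
    ch_y (b *: y + y') v = b *: ch_y y v + ch_y y' v;
  ch_g1 : forall v, ch_g 1%g v = v;
  ch_gM : forall g g' v, ch_g (g * g')%g v = ch_g g' (ch_g g v);
  ch_gx : forall g x v, ch_g g (ch_x x v) = ch_x (permv g x) (ch_g g v);
  ch_gy : forall g y v, in_h y ->
    ch_g g (ch_y y v) = ch_y (permv g y) (ch_g g v);
  ch_xx : forall x x' v, ch_x x (ch_x x' v) = ch_x x' (ch_x x v);
  ch_yy : forall y y' v, in_h y -> in_h y' ->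
    ch_y y (ch_y y' v) = ch_y y' (ch_y y v);
  ch_yx : forall y x v, in_h y ->
    ch_y y (ch_x x v) - ch_x x (ch_y y v) =
    (t * pairing x y) *: v -
    \sum_(i < 3) \sum_(j < 3 | (i < j)%N)
      (c * pairing (x - permv (tperm i j) x) y) *: ch_g (tperm i j) v
}.

Record submodule t c (M : cherednik_module t c) (N : M -> Prop) : Prop :=
  Submodule {
    sub_0 : N 0;
    sub_lin : forall b u v, N u -> N v -> N (b *: u + v);
    sub_g : forall g v, N v -> N (ch_g g v);
    sub_x : forall x v, N v -> N (ch_x x v);
    sub_y : forall y v, in_h y -> N v -> N (ch_y y v)
  }.

Definition generated_submodule t c (M : cherednik_module t c) (r : seq M) : M -> Prop :=
  fun v => forall N, submodule N -> (forall u, u \in r -> N u) -> N v.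

Lemma generated_submoduleP t c (M : cherednik_module t c) (r : seq M) :
  submodule (generated_submodule r).
Proof.
split=> [N subN _|b u v Nu Nv N subN rN|g v Nv N subN rN|x v Nv N subN rN|].
- exact: sub_0.
- by apply: sub_lin => //; [apply: Nu | apply: Nv].
- by apply: sub_g => //; apply: Nv.
- by apply: sub_x => //; apply: Nv.
- by move=> y v hy Nv N subN rN; apply: sub_y => //; apply: Nv.
Qed.

Lemma pairingC x y : pairing x y = pairing y x.
Proof. by apply: eq_bigr => i _; rewrite mulrC. Qed.

Lemma pairingDl b x x' y :
  pairing (b *: x + x') y = b * pairing x y + pairing x' y.
Proof.
rewrite /pairing mulr_sumr -big_split; apply: eq_bigr => i _ /=.
by rewrite !mxE mulrDl mulrA.
Qed.

Lemma pairingDr b x y y' :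
  pairing x (b *: y + y') = b * pairing x y + pairing x y'.
Proof. by rewrite !(pairingC x) pairingDl. Qed.

Lemma pairing_basis i y : pairing (basis3 i) y = y 0 i.
Proof.
rewrite /pairing (bigD1 i) //= big1 ?addr0 ?mxE ?eqxx ?mul1r // => j ji.
by rewrite mxE eqxx (negPf ji) mul0r.
Qed.

Lemma pairing_root i j y :
  pairing (basis3 i - basis3 j) y = y 0 i - y 0 j.
Proof.
have -> : basis3 i - basis3 j = -1 *: basis3 j + basis3 i.
  by rewrite scaleN1r addrC.
by rewrite pairingDl !pairing_basis mulN1r addrC.
Qed.

Lemma pairing_permv g x y : pairing (permv g x) (permv g y) = pairing x y.
Proof.
rewrite /pairing (reindex_inj (@perm_inj _ g)) /=; apply: eq_bigr => i _.
by rewrite !mxE permK.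
Qed.

Lemma in_hD b y y' : in_h y -> in_h y' -> in_h (b *: y + y').
Proof.
rewrite /in_h => hy hy'; under eq_bigr do rewrite !mxE.
by rewrite big_split /= -mulr_sumr hy hy' mulr0 addr0.
Qed.

Lemma in_h_permv g y : in_h y -> in_h (permv g y).
Proof.
move=> hy; rewrite /in_h (reindex_inj (@perm_inj _ g)) -[RHS]hy.
by apply: eq_bigr => i _; rewrite mxE permK.
Qed.

Lemma in_h_root i j : in_h (basis3 i - basis3 j).
Proof.
have b1 l : \sum_(i < 3) basis3 l 0 i = 1.
  rewrite (bigD1 l) //= big1 ?addr0 ?mxE ?eqxx // => m ml.
  by rewrite mxE eqxx (negPf ml).
rewrite /in_h; under eq_bigr do rewrite mxE [X in _ + X]mxE.
by rewrite big_split /= sumrN !b1 subrr.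
Qed.

Lemma permv_tperm i j x :
  permv (tperm i j) x = x - (x 0 i - x 0 j) *: (basis3 i - basis3 j).
Proof.
apply/rowP => l; rewrite !mxE eqxx /= tpermV.
case: tpermP => [->|->|/eqP/negPf li /eqP/negPf lj].
- rewrite eqxx; case: eqVneq => [->|_]; first by rewrite !subrr mulr0 subr0.
  by rewrite subr0 mulr1 subKr.
- rewrite eqxx; case: eqVneq => [->|_]; first by rewrite !subrr mulr0 subr0.
  by rewrite sub0r mulrN1 opprK addrC subrK.
- by rewrite li lj subrr mulr0 subr0.
Qed.

Lemma pairing_reflection i j x y :
  pairing (x - permv (tperm i j) x) y = (x 0 i - x 0 j) * (y 0 i - y 0 j).
Proof.
rewrite permv_tperm opprB addrCA subrr addr0.
rewrite -[_ *: _]addr0 pairingDl pairing_root [X in _ + X]big1 ?addr0 // => l _.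
by rewrite mxE mul0r.
Qed.

Lemma sum_refl_perm (V : nmodType) (F : 'I_3 -> 'I_3 -> V) g :
  (forall i j, F i j = F j i) ->
  \sum_(i < 3) \sum_(j < 3 | (i < j)%N) F (g i) (g j) =
  \sum_(i < 3) \sum_(j < 3 | (i < j)%N) F i j.
Proof.
move=> symF; pose o0 : 'I_3 := inord 0; pose o1 : 'I_3 := inord 1.
pose o2 : 'I_3 := inord 2.
have sumE (H : 'I_3 -> 'I_3 -> V) :
    \sum_(i < 3) \sum_(j < 3 | (i < j)%N) H i j = H o0 o1 + H o0 o2 + H o1 o2.
  under eq_bigr do rewrite big_mkcond /=.
  rewrite !big_ord_recl !big_ord0 /= !addr0 !add0r.
  by congr (H _ _ + H _ _ + H _ _); apply/val_inj; rewrite /= inordK.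
have oP i : [\/ i = o0, i = o1 | i = o2].
  by case: i => [[|[|[|//]]] hi]; [constructor 1 | constructor 2 | constructor 3];
     apply/val_inj; rewrite /= inordK.
rewrite !sumE.
have n01 : g o0 <> g o1 by move/perm_inj/(congr1 val); rewrite /= !inordK.
have n02 : g o0 <> g o2 by move/perm_inj/(congr1 val); rewrite /= !inordK.
have n12 : g o1 <> g o2 by move/perm_inj/(congr1 val); rewrite /= !inordK.
move: n01 n02 n12.
case: (oP (g o0)) => ->; case: (oP (g o1)) => ->; case: (oP (g o2)) => -> n1 n2 n3 //=.
- by rewrite (symF o2 o1) [LHS](ACl (2*1*3)).
- by rewrite (symF o1 o0) [LHS](ACl (1*3*2)).
- by rewrite (symF o1 o0) (symF o2 o0) [LHS](ACl (2*3*1)).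
- by rewrite (symF o2 o0) (symF o2 o1) [LHS](ACl (3*1*2)).
- by rewrite (symF o2 o1) (symF o2 o0) (symF o1 o0) [LHS](ACl (3*2*1)).
Qed.

End Reflection.


Section Verma.
Variable k : fieldType.

(* S h^* as the polynomial algebra on the basis xbar_1, xbar_2 of h^*. *)
Local Notation Sh := {mpoly k[2]}.
Implicit Types (f u : Sh) (a x y z : 'rV[k]_3) (g : 'S_3).

Definition xbar (i : 'I_3) : Sh :=
  [:: 'X_ord0; 'X_ord_max; - ('X_ord0 + 'X_ord_max)]`_i.

Definition widen23 (i : 'I_2) : 'I_3 := widen_ord (isT : (2 <= 3)%N) i.

Definition Sh_lin x : Sh := \sum_(i < 3) x 0 i *: xbar i.

Definition Sh_act g f : Sh := f \mPo [tuple xbar (g (widen23 i)) | i < 2].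

Definition Sh_deriv y f : Sh := \sum_(i < 2) y 0 (widen23 i) *: f^`M(i).

(* (1 - (ij)) f / (x_i - x_j); see [divdiffP] for the existence of the
   quotient. *)
Definition divdiff (i j : 'I_3) f : Sh :=
  epsilon (inhabits 0)
    (fun u => u * (xbar i - xbar j) = f - Sh_act (tperm i j) f).

(* The Dunkl operator D_y of M_{t,c}(Triv), for y in h. *)
Definition dunkl (t c : k) y f : Sh :=
  t *: Sh_deriv y f -
  \sum_(i < 3) \sum_(j < 3 | (i < j)%N)
    (c * pairing (basis3 k i - basis3 k j) y) *: divdiff i j f.

Lemma xbar_w i : xbar (widen23 i) = 'X_i.
Proof.
case: i => [[|[|//]] hi]; rewrite /xbar /=; congr 'X_ _; exact: val_inj.
Qed.

Lemma sum_xbar : \sum_(i < 3) xbar i = 0.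
Proof. by rewrite !big_ord_recl big_ord0 /xbar /= addr0 addrA subrr. Qed.

Lemma I3_ind (P : 'I_3 -> Prop) :
  (forall i, P (widen23 i)) -> P ord_max -> forall i, P i.
Proof.
move=> Pw Pm [[|[|[|//]]] hi].
- by have := Pw ord0; congr P; apply: val_inj.
- by have := Pw ord_max; congr P; apply: val_inj.
- by move: Pm; congr P; apply: val_inj.
Qed.

Lemma sum3E (V : zmodType) (F : 'I_3 -> V) :
  \sum_i F i = \sum_(i < 2) F (widen23 i) + F ord_max.
Proof.
rewrite big_ord_recr /=; congr (_ + _); apply: eq_bigr => i _.
by congr F; apply: val_inj.
Qed.

Lemma xbar_max : xbar ord_max = - \sum_(i < 2) xbar (widen23 i).
Proof. by have /eqP := sum_xbar; rewrite sum3E addrC addr_eq0 => /eqP. Qed.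

Lemma Sh_ind (P : Sh -> Prop) :
  P 1 -> (forall b f u, P f -> P u -> P (b *: f + u)) ->
  (forall i f, P f -> P (xbar i * f)) -> forall f, P f.
Proof.
move=> P1 PD PX.
have P0 : P 0 by rewrite -(addNr 1) -scaleN1r; apply: PD.
elim/mpolyind => // b m f _ _ Pf; apply: PD => //.
rewrite mpolyXE_id; elim: (index_enum _) => [|i r IHr]; first by rewrite big_nil.
rewrite big_cons; elim: (m i) => [|n IHn]; first by rewrite expr0 mul1r.
by rewrite exprS -mulrA -xbar_w; apply: PX; rewrite xbar_w.
Qed.

Lemma Sh_act_linear g : linear (Sh_act g).
Proof. by move=> b f u; rewrite /Sh_act linearP. Qed.

Lemma Sh_actM g f u : Sh_act g (f * u) = Sh_act g f * Sh_act g u.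
Proof. by rewrite /Sh_act rmorphM. Qed.

Lemma Sh_act_one g : Sh_act g 1 = 1.
Proof. by rewrite /Sh_act rmorph1. Qed.

Lemma Sh_actB g f u : Sh_act g (f - u) = Sh_act g f - Sh_act g u.
Proof. by rewrite /Sh_act linearB. Qed.

Lemma Sh_actZ g b f : Sh_act g (b *: f) = b *: Sh_act g f.
Proof. by rewrite /Sh_act linearZ. Qed.

Lemma Sh_act_sum g (I : finType) (Q : pred I) (F : I -> Sh) :
  Sh_act g (\sum_(i | Q i) F i) = \sum_(i | Q i) Sh_act g (F i).
Proof. by rewrite /Sh_act linear_sum. Qed.

Lemma Sh_act_xbar g i : Sh_act g (xbar i) = xbar (g i).
Proof.
elim/I3_ind: i => [i|].
  by rewrite xbar_w /Sh_act comp_mpolyXU -tnth_nth tnth_mktuple.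
have actN f : Sh_act g (- f) = - Sh_act g f by rewrite /Sh_act linearN.
rewrite xbar_max actN Sh_act_sum.
have /eqP := sum_xbar; rewrite (reindex_inj (@perm_inj _ g)) sum3E addrC addr_eq0.
move=> /eqP ->; congr (- _); apply: eq_bigr => i _.
by rewrite xbar_w /Sh_act comp_mpolyXU -tnth_nth tnth_mktuple.
Qed.

Lemma Sh_act1 f : Sh_act 1%g f = f.
Proof.
elim/Sh_ind: f => [|b f u IHf IHu|i f IHf]; first exact: Sh_act_one.
  by rewrite Sh_act_linear IHf IHu.
by rewrite Sh_actM IHf Sh_act_xbar perm1.
Qed.

Lemma Sh_act_comp g g' f : Sh_act (g * g')%g f = Sh_act g' (Sh_act g f).
Proof.
elim/Sh_ind: f => [|b f u IHf IHu|i f IHf]; first by rewrite !Sh_act_one.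
  by rewrite !Sh_act_linear IHf IHu.
by rewrite !Sh_actM IHf !Sh_act_xbar permM.
Qed.

Lemma Sh_lin_linear : linear Sh_lin.
Proof.
move=> b x x'; rewrite /Sh_lin scaler_sumr -big_split; apply: eq_bigr => i _ /=.
by rewrite !mxE scalerDl scalerA.
Qed.

Lemma Sh_lin_basis i : Sh_lin (basis3 k i) = xbar i.
Proof.
rewrite /Sh_lin (bigD1 i) //= big1 ?addr0 ?mxE ?eqxx ?scale1r // => j ji.
by rewrite mxE eqxx (negPf ji) scale0r.
Qed.

Lemma Sh_act_lin g x : Sh_act g (Sh_lin x) = Sh_lin (permv g x).
Proof.
rewrite /Sh_lin Sh_act_sum [RHS](reindex_inj (@perm_inj _ g)) /=.
by apply: eq_bigr => i _; rewrite Sh_actZ Sh_act_xbar !mxE permK.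
Qed.

Lemma Sh_lin_reflection i j x :
  Sh_lin x - Sh_lin (permv (tperm i j) x) =
  (x 0 i - x 0 j) *: (xbar i - xbar j).
Proof.
have ShB y z : Sh_lin (y - z) = Sh_lin y - Sh_lin z.
  by rewrite addrC -scaleN1r Sh_lin_linear scaleN1r addrC.
have Sh0 : Sh_lin 0 = 0 by rewrite /Sh_lin big1 // => l _; rewrite mxE scale0r.
rewrite -ShB permv_tperm opprB addrCA subrr addr0.
by rewrite -[_ *: _ in LHS]addr0 Sh_lin_linear Sh0 addr0 ShB !Sh_lin_basis.
Qed.

Lemma xbar_neq i j : i != j -> xbar i - xbar j != 0.
Proof.
have one0 : 1 != 0 :> k := oner_neq0 k.
move=> ij; suff [l hl] : exists l : 'I_2, (xbar i - xbar j)@_U_(l) != 0.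
  by apply: contraNneq hl => ->; rewrite mcoeff0.
move: i j ij => [[|[|[|//]]] hi] [[|[|[|//]]] hj] //= _; rewrite /xbar /=;
[exists ord0|exists ord_max|exists ord0|exists ord0|exists ord_max|exists ord0];
by rewrite mcoeffB ?mcoeffN ?mcoeffD !mcoeffXU /= ?opprK ?addr0 ?add0r ?subr0
           ?sub0r ?oppr_eq0 ?opprD ?subr0.
Qed.

Lemma Sh_deriv_linear y : linear (Sh_deriv y).
Proof.
move=> b f u; rewrite /Sh_deriv scaler_sumr -big_split; apply: eq_bigr => i _.
by rewrite linearP /= scalerDr !scalerA mulrC.
Qed.

Lemma Sh_derivD b y y' f :
  Sh_deriv (b *: y + y') f = b *: Sh_deriv y f + Sh_deriv y' f.
Proof.
rewrite /Sh_deriv scaler_sumr -big_split; apply: eq_bigr => i _ /=.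
by rewrite !mxE scalerDl scalerA.
Qed.

Lemma Sh_deriv1 y : Sh_deriv y 1 = 0.
Proof. by rewrite /Sh_deriv big1 // => i _; rewrite -mpolyC1 mderivC scaler0. Qed.

Lemma Sh_derivM y f u :
  Sh_deriv y (f * u) = Sh_deriv y f * u + f * Sh_deriv y u.
Proof.
rewrite /Sh_deriv mulr_suml mulr_sumr -big_split; apply: eq_bigr => i _ /=.
by rewrite mderivM scalerDr scalerAl scalerAr.
Qed.

Lemma Sh_deriv_xbar y i : in_h y -> Sh_deriv y (xbar i) = (y 0 i)%:MP.
Proof.
move=> hy; have w j : Sh_deriv y (xbar (widen23 j)) = (y 0 (widen23 j))%:MP.
  rewrite /Sh_deriv (bigD1 j) //= big1 ?addr0 => [|l lj].
    rewrite xbar_w mderivX mnm1E eqxx scale1r -[X in (X - _)%MM]add0m addmK.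
    by rewrite mpolyX0 -mul_mpolyC mulr1.
  by rewrite xbar_w mderivX mnm1E eq_sym (negPf lj) scale0r scaler0.
elim/I3_ind: i => // ; have D0 : Sh_deriv y 0 = 0.
  by rewrite /Sh_deriv big1 // => i _; rewrite mderiv0 scaler0.
have DN f : Sh_deriv y (- f) = - Sh_deriv y f.
  by rewrite -scaleN1r -[_ *: f]addr0 Sh_deriv_linear D0 addr0 scaleN1r.
have DD f u : Sh_deriv y (f + u) = Sh_deriv y f + Sh_deriv y u.
  by rewrite -[f]scale1r Sh_deriv_linear !scale1r.
rewrite xbar_max DN (big_morph _ DD D0) (eq_bigr _ (fun j _ => w j)).
by move/eqP: hy; rewrite sum3E addrC addr_eq0 => /eqP ->; rewrite rmorphN rmorph_sum.
Qed.

Lemma Sh_deriv_linM y x f : in_h y ->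
  Sh_deriv y (Sh_lin x * f) = pairing x y *: f + Sh_lin x * Sh_deriv y f.
Proof.
move=> hy; rewrite Sh_derivM; congr (_ + _).
have D0 : Sh_deriv y 0 = 0.
  by rewrite /Sh_deriv big1 // => i _; rewrite mderiv0 scaler0.
have DZ b u : Sh_deriv y (b *: u) = b *: Sh_deriv y u.
  by rewrite -[_ *: u]addr0 Sh_deriv_linear D0 addr0.
have DD u u' : Sh_deriv y (u + u') = Sh_deriv y u + Sh_deriv y u'.
  by rewrite -[u]scale1r Sh_deriv_linear !scale1r.
rewrite -mul_mpolyC; congr (_ * f).
rewrite /Sh_lin (big_morph _ DD D0) /pairing rmorph_sum; apply: eq_bigr => i _ /=.
by rewrite DZ Sh_deriv_xbar // rmorphM -mul_mpolyC.
Qed.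

Lemma divdiff_uniq i j f u : i != j ->
  u * (xbar i - xbar j) = f - Sh_act (tperm i j) f -> divdiff i j f = u.
Proof.
move=> ij uP; apply: (mulIf (xbar_neq ij)); rewrite uP.
exact: (epsilon_spec (inhabits (0 : Sh))
  (fun w => w * (xbar i - xbar j) = f - Sh_act (tperm i j) f)
  (ex_intro _ u uP)).
Qed.

Lemma divdiffP i j f :
  divdiff i j f * (xbar i - xbar j) = f - Sh_act (tperm i j) f.
Proof.
apply: (epsilon_spec (inhabits (0 : Sh))
  (fun w => w * (xbar i - xbar j) = f - Sh_act (tperm i j) f)).
elim/Sh_ind: f => [|b f u [f' fE] [u' uE]|l f [f' fE]].
- by exists 0; rewrite mul0r Sh_act_one subrr.
- exists (b *: f' + u'); rewrite mulrDl -scalerAl fE uE Sh_act_linear.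
  by rewrite scalerBr opprD addrACA.
- have := Sh_lin_reflection i j (basis3 k l).
  rewrite -Sh_act_lin Sh_lin_basis => lE.
  set b := basis3 k l 0 i - _ in lE.
  exists (b *: Sh_act (tperm i j) f + xbar l * f').
  rewrite mulrDl -mulrA fE -scalerAl mulrC scalerAl -lE Sh_actM mulrBl mulrBr.
  by rewrite addrC addrA subrK.
Qed.

Lemma divdiff_linear i j : i != j -> linear (divdiff i j).
Proof.
move=> ij b f u; apply: divdiff_uniq => //.
by rewrite mulrDl -scalerAl !divdiffP Sh_act_linear scalerBr opprD addrACA.
Qed.

Lemma divdiff1 i j : i != j -> divdiff i j 1 = 0.
Proof.
by move=> ij; apply: divdiff_uniq => //; rewrite mul0r Sh_act_one subrr.
Qed.

Lemma divdiff_linM i j x f : i != j ->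
  divdiff i j (Sh_lin x * f) =
  Sh_lin x * divdiff i j f + (x 0 i - x 0 j) *: Sh_act (tperm i j) f.
Proof.
move=> ij; apply: divdiff_uniq => //; rewrite Sh_actM Sh_act_lin mulrDl -mulrA.
rewrite divdiffP -scalerAl (mulrC (Sh_act _ _) (_ - _)) scalerAl.
by rewrite -Sh_lin_reflection mulrBl mulrBr addrA subrK.
Qed.

Lemma refl_sum_lin b (F G : 'I_3 -> 'I_3 -> Sh) :
  \sum_(i < 3) \sum_(j < 3 | (i < j)%N) (b *: F i j + G i j) =
  b *: (\sum_(i < 3) \sum_(j < 3 | (i < j)%N) F i j) +
  \sum_(i < 3) \sum_(j < 3 | (i < j)%N) G i j.
Proof.
rewrite scaler_sumr -big_split; apply: eq_bigr => i _ /=.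
by rewrite scaler_sumr -big_split.
Qed.

Lemma eq_refl_sum (F G : 'I_3 -> 'I_3 -> Sh) :
  (forall i j, i != j -> F i j = G i j) ->
  \sum_(i < 3) \sum_(j < 3 | (i < j)%N) F i j =
  \sum_(i < 3) \sum_(j < 3 | (i < j)%N) G i j.
Proof.
move=> FG; apply: eq_bigr => i _; apply: eq_bigr => j ij.
by rewrite FG // neq_ltn ij.
Qed.

Lemma dunkl_linear t c y : linear (dunkl t c y).
Proof.
move=> b f u; rewrite /dunkl Sh_deriv_linear scalerDr scalerBr addrACA -opprD.
rewrite -refl_sum_lin !scalerA (mulrC t); congr (_ - _).
apply: eq_refl_sum => i j ij.
by rewrite divdiff_linear // scalerDr !scalerA (mulrC b).
Qed.

Lemma dunklD t c b y y' f :
  dunkl t c (b *: y + y') f = b *: dunkl t c y f + dunkl t c y' f.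
Proof.
rewrite /dunkl Sh_derivD scalerDr scalerBr addrACA -opprD.
rewrite -refl_sum_lin !scalerA (mulrC t); congr (_ - _).
apply: eq_refl_sum => i j ij.
by rewrite pairingDr mulrDr mulrCA scalerDl scalerA.
Qed.

Lemma dunkl1 t c y : dunkl t c y 1 = 0.
Proof.
rewrite /dunkl Sh_deriv1 scaler0 big1 ?subr0 // => i _; rewrite big1 // => j ij.
by rewrite divdiff1 ?scaler0 // neq_ltn ij.
Qed.

Definition dunkl_comm t c y x f : Sh :=
  (t * pairing x y) *: f -
  \sum_(i < 3) \sum_(j < 3 | (i < j)%N)
    (c * pairing (x - permv (tperm i j) x) y) *: Sh_act (tperm i j) f.

Lemma dunkl_linM t c y x f : in_h y ->
  dunkl t c y (Sh_lin x * f) = Sh_lin x * dunkl t c y f + dunkl_comm t c y x f.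
Proof.
move=> hy; rewrite /dunkl /dunkl_comm Sh_deriv_linM //.
rewrite mulrBr scalerDr scalerA -scalerAr.
rewrite (addrC (_ *: f)) [RHS]addrACA -opprD; congr (_ - _).
rewrite mulr_sumr -big_split; apply: eq_bigr => i _ /=.
rewrite mulr_sumr -big_split; apply: eq_bigr => j ij /=.
rewrite divdiff_linM ?neq_ltn ?ij // scalerDr -scalerAr scalerA.
by rewrite pairing_root pairing_reflection -mulrA (mulrC (x 0 i - _)).
Qed.

Lemma linear_comp_eq (P Q P' Q' : Sh -> Sh) b f u :
  linear P -> linear Q -> linear P' -> linear Q' ->
  P (Q f) = P' (Q' f) -> P (Q u) = P' (Q' u) ->
  P (Q (b *: f + u)) = P' (Q' (b *: f + u)).
Proof. by move=> lP lQ lP' lQ' Ef Eu; rewrite lQ lP lQ' lP' Ef Eu. Qed.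

Lemma dunkl_act t c y g f : in_h y ->
  Sh_act g (dunkl t c y f) = dunkl t c (permv g y) (Sh_act g f).
Proof.
move=> hy; have act0 : Sh_act g 0 = 0 by have := Sh_actZ g 0 0; rewrite !scale0r.
elim/Sh_ind: f => [|b f u IHf IHu|l f IHf].
- by rewrite Sh_act_one !dunkl1 act0.
- exact: (linear_comp_eq b (Sh_act_linear g) (dunkl_linear t c y)
           (dunkl_linear t c (permv g y)) (Sh_act_linear g) IHf IHu).
rewrite -Sh_lin_basis Sh_actM Sh_act_lin !dunkl_linM //; last exact: in_h_permv.
rewrite -IHf -Sh_act_lin -Sh_actM.
set x := basis3 k l; set v := _ * _.
rewrite -[v]scale1r Sh_act_linear !scale1r; congr (_ + _).
rewrite Sh_actB Sh_actZ /dunkl_comm pairing_permv; congr (_ - _).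
rewrite -[RHS](sum_refl_perm g); last first; first by move=> i j; rewrite tpermC.
rewrite Sh_act_sum; apply: eq_bigr => i _; rewrite Sh_act_sum.
apply: eq_bigr => j _; rewrite Sh_actZ -!Sh_act_comp; congr (_ *: Sh_act _ f).
  by rewrite !pairing_reflection !mxE !permK.
by apply/permP => m; rewrite !permM inj_tperm //; exact: perm_inj.
Qed.

Lemma dunklB t c y z f :
  dunkl t c (y - z) f = dunkl t c y f - dunkl t c z f.
Proof. by rewrite addrC -scaleN1r dunklD scaleN1r addrC. Qed.

Lemma dunkl_dunkl_step (D : 'rV[k]_3 -> Sh -> Sh) (S : 'S_3 -> Sh -> Sh)
    (t c : k) x y z (l f : Sh) :
  (forall w, linear (D w)) ->
  (forall b w w' u, D (b *: w + w') u = b *: D w u + D w' u) ->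
  (forall w u, w \in [:: y; z] -> D w (l * u) = l * D w u +
    ((t * pairing x w) *: u - \sum_(i < 3) \sum_(j < 3 | (i < j)%N)
      (c * pairing (x - permv (tperm i j) x) w) *: S (tperm i j) u)) ->
  (forall g w u, w \in [:: y; z] -> S g (D w u) = D (permv g w) (S g u)) ->
  D y (D z f) = D z (D y f) -> D y (D z (l * f)) = D z (D y (l * f)).
Proof.
move=> Dlin DD DlM DS DC.
have hy : y \in [:: y; z] by rewrite mem_head.
have hz : z \in [:: y; z] by rewrite !inE eqxx orbT.
have D0 w : D w 0 = 0.
  by have := Dlin w (-1) 0 0; rewrite !scaleN1r oppr0 addr0 addNr.
have DZ w b u : D w (b *: u) = b *: D w u.
  by have := Dlin w b u 0; rewrite D0 !addr0.
have DA w u v : D w (u + v) = D w u + D w v.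
  by have := Dlin w 1 u v; rewrite !scale1r.
have DN w u : D w (- u) = - D w u by rewrite -scaleN1r DZ scaleN1r.
have Dr b i j u w : D (w - b *: (basis3 k i - basis3 k j)) u =
    D w u - b *: D (basis3 k i - basis3 k j) u.
  by rewrite addrC -scaleNr DD scaleNr addrC.
pose T w w' := \sum_(i < 3) \sum_(j < 3 | (i < j)%N)
  (c * pairing (x - permv (tperm i j) x) w) *: D w' (S (tperm i j) f).
pose U := \sum_(i < 3) \sum_(j < 3 | (i < j)%N)
  (c * (x 0 i - x 0 j) * (y 0 i - y 0 j) * (z 0 i - z 0 j)) *:
    D (basis3 k i - basis3 k j) (S (tperm i j) f).
have DT w w' : D w' (\sum_(i < 3) \sum_(j < 3 | (i < j)%N)
    (c * pairing (x - permv (tperm i j) x) w) *: S (tperm i j) f) = T w w'.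
  rewrite (big_morph _ (DA w') (D0 w')); apply: eq_bigr => i _.
  by rewrite (big_morph _ (DA w') (D0 w')); apply: eq_bigr => j _; rewrite DZ.
have TU (w w' : 'rV[k]_3) : w' \in [:: y; z] ->
  (forall i j, (w 0 i - w 0 j) * (w' 0 i - w' 0 j) =
     (y 0 i - y 0 j) * (z 0 i - z 0 j)) ->
  \sum_(i < 3) \sum_(j < 3 | (i < j)%N)
    (c * pairing (x - permv (tperm i j) x) w) *: S (tperm i j) (D w' f) =
  T w w' - U.
  move=> hw' ww'; rewrite /T /U -sumrB; apply: eq_bigr => i _.
  rewrite -sumrB; apply: eq_bigr => j _.
  rewrite DS // [permv _ w']permv_tperm Dr scalerBr scalerA pairing_reflection.
  by congr (_ - _ *: _); rewrite -!mulrA ww'.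
rewrite !DlM // !DA !DlM // !DN !DZ !DT TU // TU //; last first.
  by move=> i j; rewrite mulrC.
rewrite DC; move: (T y z) (T z y) (_ *: D z f) (_ *: D y f) => a b a' b'.
by ring.
Qed.

Lemma dunkl_dunkl t c y z f : in_h y -> in_h z ->
  dunkl t c y (dunkl t c z f) = dunkl t c z (dunkl t c y f).
Proof.
move=> hy hz; elim/Sh_ind: f => [|b f u IHf IHu|l f IHf].
- by rewrite !dunkl1 -(subrr (1 : Sh)) -scaleN1r addrC !dunkl_linear !dunkl1.
- exact: (linear_comp_eq b (dunkl_linear t c y) (dunkl_linear t c z)
           (dunkl_linear t c z) (dunkl_linear t c y) IHf IHu).
rewrite -Sh_lin_basis.
apply: (@dunkl_dunkl_step (dunkl t c) Sh_act t c (basis3 k l)).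
- exact: dunkl_linear.
- by move=> *; exact: dunklD.
- by move=> w u; rewrite !inE => /orP[] /eqP ->; rewrite dunkl_linM.
- by move=> g w u; rewrite !inE => /orP[] /eqP ->; apply: dunkl_act.
- exact: IHf.
Qed.

Lemma Sh_lin_ones : Sh_lin (const_mx 1) = 0.
Proof.
by rewrite -sum_xbar; apply: eq_bigr => i _; rewrite mxE scale1r.
Qed.

Lemma Sh_mul_linear u : linear (fun f => u * f).
Proof. by move=> b f f'; rewrite mulrDr -scalerAr. Qed.

Lemma Sh_lin_mulD b x x' f :
  Sh_lin (b *: x + x') * f = b *: (Sh_lin x * f) + Sh_lin x' * f.
Proof. by rewrite Sh_lin_linear mulrDl -scalerAl. Qed.

Lemma Sh_lin_mul1 f : Sh_lin (const_mx 1) * f = 0.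
Proof. by rewrite Sh_lin_ones mul0r. Qed.

Lemma Sh_act_mul_lin g x f :
  Sh_act g (Sh_lin x * f) = Sh_lin (permv g x) * Sh_act g f.
Proof. by rewrite Sh_actM Sh_act_lin. Qed.

Lemma Sh_lin_mulC x x' f : Sh_lin x * (Sh_lin x' * f) = Sh_lin x' * (Sh_lin x * f).
Proof. by rewrite mulrCA. Qed.

Lemma dunkl_lin t c y x f : in_h y ->
  dunkl t c y (Sh_lin x * f) - Sh_lin x * dunkl t c y f =
  (t * pairing x y) *: f -
  \sum_(i < 3) \sum_(j < 3 | (i < j)%N)
    (c * pairing (x - permv (tperm i j) x) y) *: Sh_act (tperm i j) f.
Proof. by move=> hy; rewrite dunkl_linM // addrC addKr. Qed.

(* M_{t,c}(Triv) = S h^*, see [verma_universal]. *)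
Definition verma (t c : k) : cherednik_module t c :=
  @CherednikModule k t c Sh Sh_act (fun x f => Sh_lin x * f) (dunkl t c)
    Sh_act_linear (fun x => Sh_mul_linear (Sh_lin x))
    (fun y _ => dunkl_linear t c y) Sh_lin_mulD Sh_lin_mul1
    (fun b y y' f _ _ => dunklD t c b y y' f) Sh_act1 Sh_act_comp
    Sh_act_mul_lin (fun g y f => dunkl_act t c g f) Sh_lin_mulC
    (fun y y' f => @dunkl_dunkl t c y y' f) (fun y x f => dunkl_lin t c x f).

Section Universal.
Variables (t c : k) (M : cherednik_module t c) (v : M).
Hypothesis v_g : forall g, ch_g g v = v.
Hypothesis v_y : forall y, in_h y -> ch_y y v = 0.

Let X (i : 'I_2) : M -> M := ch_x (basis3 k (widen23 i)).
Let mon (m : 'X_{1..2}) : M := iter (m ord0) (X ord0) (iter (m ord_max) (X ord_max) v).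
Let phi (f : Sh) : M := \sum_(m <- msupp f) f@_m *: mon m.

Let phiE d f : (msize f <= d)%N -> phi f = \sum_(m : 'X_{1..2 < d}) f@_m *: mon m.
Proof.
move=> fd; rewrite /phi (big_mksub ('X_{1..2 < d})) //=; first last.
- by move=> m /msize_mdeg_lt /leq_trans; apply.
- exact: msupp_uniq.
by rewrite big_rmcond //= => i /memN_msupp_eq0 ->; rewrite scale0r.
Qed.

Let phi_linear : linear phi.
Proof.
move=> b f u; pose d := maxn (msize (b *: f + u)) (maxn (msize f) (msize u)).
rewrite !(@phiE d) ?leq_max ?leqnn ?orbT // scaler_sumr -big_split /=.
by apply: eq_bigr => m _; rewrite mcoeffD mcoeffZ scalerDl scalerA.
Qed.

Let phiX m : phi 'X_[m] = mon m.
Proof. by rewrite /phi msuppX big_seq1 mcoeffX eqxx scale1r. Qed.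

Let phi1 : phi 1 = v.
Proof. by rewrite -mpolyX0 phiX /mon !mnm0E. Qed.

Let XC i w : X i (X ord0 w) = X ord0 (X i w).
Proof. by rewrite /X ch_xx. Qed.

Let monS i m : mon (U_(i) + m)%MM = X i (mon m).
Proof.
have it n w : iter n (X ord0) (X i w) = X i (iter n (X ord0) w).
  by elim: n => //= n ->; rewrite XC.
have [E|E] : i = ord0 \/ i = ord_max.
- by case: i {it} => [[|[|//]] hi]; [left | right]; apply: val_inj.
- by rewrite E /mon !mnmDE !mnm1E.
- by rewrite E in it *; rewrite /mon !mnmDE !mnm1E -it.
Qed.

Let phi0 : phi 0 = 0.
Proof. by rewrite /phi msupp0 big_nil. Qed.

Let phiZ b f : phi (b *: f) = b *: phi f.
Proof. by have := phi_linear b f 0; rewrite phi0 !addr0. Qed.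

Let phiD f u : phi (f + u) = phi f + phi u.
Proof. by have := phi_linear 1 f u; rewrite !scale1r. Qed.

Let phiN f : phi (- f) = - phi f.
Proof. by rewrite -[- f]scaleN1r phiZ scaleN1r. Qed.

Let ch_x00 (w : M) : ch_x (0 : 'rV[k]_3) w = 0.
Proof.
have := ch_xD (-1) (0 : 'rV[k]_3) 0 w.
by rewrite !scaleN1r oppr0 addr0 addNr.
Qed.

Let ch_xZ b x (w : M) : ch_x (b *: x) w = b *: ch_x x w.
Proof. by have := ch_xD b x 0 w; rewrite ch_x00 !addr0. Qed.

Let ch_xA x x' (w : M) : ch_x (x + x') w = ch_x x w + ch_x x' w.
Proof. by have := ch_xD 1 x x' w; rewrite !scale1r. Qed.

Let lin0 (h : M -> M) : linear h -> h 0 = 0.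
Proof. by move=> hl; have := hl (-1) 0 0; rewrite !scaleN1r oppr0 addr0 addNr. Qed.

Let phi_w i f : phi ('X_i * f) = X i (phi f).
Proof.
have Xl : linear (X i) by apply: ch_x_linear.
elim/mpolyind: f => [|b m f _ _ IHf]; first by rewrite mulr0 phi0 lin0.
by rewrite mulrDr -scalerAr -mpolyXD !phi_linear IHf Xl !phiX monS.
Qed.

Let phi_xbar i f : phi (xbar i * f) = ch_x (basis3 k i) (phi f).
Proof.
elim/I3_ind: i => [i|]; first by rewrite xbar_w phi_w.
rewrite xbar_max mulNr phiN mulr_suml (big_morph _ phiD phi0).
have := ch_x0 (phi f); have -> : const_mx 1 = \sum_i basis3 k i :> 'rV[k]_3.
  apply/rowP => j; rewrite mxE summxE (bigD1 j) //= big1 ?addr0 ?mxE ?eqxx //.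
  by move=> i ij; rewrite mxE eq_sym (negPf ij).
rewrite sum3E addrC ch_xA => /eqP; rewrite addr_eq0 => /eqP ->.
rewrite (big_morph (fun x => ch_x x (phi f)) (fun x x' => ch_xA x x' _) (ch_x00 _)).
by congr (- _); apply: eq_bigr => i _; rewrite xbar_w phi_w.
Qed.

Let phi_x x f : phi (Sh_lin x * f) = ch_x x (phi f).
Proof.
rewrite /Sh_lin mulr_suml (big_morph _ phiD phi0) {2}[x]row_sum_delta.
rewrite (big_morph (fun x => ch_x x (phi f)) (fun x x' => ch_xA x x' _) (ch_x00 _)).
by apply: eq_bigr => i _; rewrite -scalerAl phiZ phi_xbar ch_xZ.
Qed.

Let phi_g g f : phi (Sh_act g f) = ch_g g (phi f).
Proof.
elim/Sh_ind: f => [|b f u IHf IHu|i f IHf].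
- by rewrite Sh_act_one phi1 v_g.
- by rewrite Sh_act_linear !phi_linear IHf IHu ch_g_linear.
- by rewrite -Sh_lin_basis Sh_act_mul_lin !phi_x IHf ch_gx.
Qed.

Let phi_y y f : in_h y -> phi (dunkl t c y f) = ch_y y (phi f).
Proof.
move=> hy; elim/Sh_ind: f => [|b f u IHf IHu|i f IHf].
- by rewrite dunkl1 phi0 phi1 v_y.
- rewrite (dunkl_linear t c y b f u) (phi_linear b f u).
  move: (dunkl t c y f) (dunkl t c y u) IHf IHu => f' u' IHf IHu.
  by rewrite phi_linear IHf IHu ch_y_linear.
rewrite -Sh_lin_basis (dunkl_linM t c _ _ hy).
move: (dunkl t c y f) IHf => f' IHf; rewrite phiD !phi_x IHf.
rewrite -[RHS](subrK (ch_x (basis3 k i) (ch_y y (phi f)))) ch_yx // addrC.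
congr (_ + _); rewrite /dunkl_comm phiD phiN phiZ; congr (_ - _).
rewrite (big_morph _ phiD phi0); apply: eq_bigr => j _.
by rewrite (big_morph _ phiD phi0); apply: eq_bigr => l _; rewrite phiZ phi_g.
Qed.

(* S h^* is H (x)_{k[S_3] |x S h} Triv: the morphisms from it to a module M are
   the vectors of M that are fixed by S_3 and killed by h. *)
Lemma verma_universal :
  exists! h : verma t c -> M,
    [/\ linear h, h (1 : Sh) = v, forall g (f : verma t c), h (ch_g g f) = ch_g g (h f),
        forall x (f : verma t c), h (ch_x x f) = ch_x x (h f) &
        forall y (f : verma t c), in_h y -> h (ch_y y f) = ch_y y (h f)].
Proof.
exists phi; split; first by split=> //; exact: phi_y.
move=> h [hl h1 hg hx hy]; apply: functional_extensionality => f.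
move: f; apply: Sh_ind => [|b f u IHf IHu|i f IHf].
- by rewrite phi1 h1.
- by rewrite phi_linear hl IHf IHu.
- by rewrite phi_xbar IHf -hx /= Sh_lin_basis.
Qed.

End Universal.

End Verma.

Section GradedPiece.
Variable k : fieldType.
Local Notation Sh := {mpoly k[2]}.
Local Notation grepr := (representation k [set: 'S_3]).
Implicit Types (f : Sh) (g : 'S_3) (N : Sh -> Prop).

(* rho is the S_3-representation (Sh / N)^d = Sh^d / (N \cap Sh^d).  Matrices
   act on rows from the right, which agrees with the left action of S_3 on Sh
   because of the left to right composition of permutations. *)
Definition affords_piece N (d : nat) (rho : grepr) : Prop :=
  exists pi : {linear Sh -> 'rV[k]_(rdegree rho)},
    [/\ forall w, exists2 f, f \is d.-homog & pi f = w,
        forall f, f \is d.-homog -> (pi f = 0 <-> N f) &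
        forall g f, f \is d.-homog -> pi (Sh_act g f) = pi f *m rho g].

Definition piece N (d : nat) : grepr :=
  epsilon (inhabits grepr0) (affords_piece N d).

Let dmon (d : nat) (i : 'I_d.+1) : 'X_{1..2} :=
  [multinom (if j == ord0 then (i : nat) else (d - i)%N) | j < 2].

Let dcoord (d : nat) f : 'rV[k]_d.+1 := \row_i f@_(dmon i).
Let dpoly (d : nat) (w : 'rV[k]_d.+1) : Sh := \sum_i w 0 i *: 'X_[dmon i].

Let dmon_deg d i : mdeg (@dmon d i) = d.
Proof.
rewrite mdegE !big_ord_recl big_ord0 !mnmE /= addn0 subnKC //.
by rewrite -ltnS.
Qed.

Let dmon_inj d : injective (@dmon d).
Proof. by move=> i j /mnmP/(_ ord0); rewrite !mnmE /= => /val_inj. Qed.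

Let dmonP d m : mdeg m = d -> exists i : 'I_d.+1, m = dmon i.
Proof.
rewrite mdegE !big_ord_recl big_ord0 /= addn0 => md.
have hi : (m ord0 < d.+1)%N by rewrite ltnS -md leq_addr.
exists (Ordinal hi); apply/mnmP => j; rewrite !mnmE /=.
case: eqVneq => [->//|j0]; rewrite -md addKn; congr (m _); apply: val_inj.
by case: j j0 => [[|[|//]]].
Qed.

Let dpolyK d : cancel (@dpoly d) (@dcoord d).
Proof.
move=> w; apply/rowP => i; rewrite mxE /dpoly raddf_sum (bigD1 i) //=.
rewrite mcoeffZ mcoeffX eqxx mulr1 big1 ?addr0 // => j ji.
by rewrite mcoeffZ mcoeffX (inj_eq (@dmon_inj d)) (negPf ji) mulr0.
Qed.

Let dcoordK d f : f \is d.-homog -> dpoly (dcoord d f) = f.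
Proof.
move=> /dhomogP fd; apply/mpolyP => m; rewrite /dpoly raddf_sum /=.
have [md|md] := eqVneq (mdeg m) d.
  have [i ->] := dmonP md; rewrite (bigD1 i) //= mxE mcoeffZ mcoeffX eqxx mulr1.
  rewrite big1 ?addr0 // => j ji.
  by rewrite mcoeffZ mcoeffX (inj_eq (@dmon_inj d)) (negPf ji) mulr0.
rewrite big1 => [|i _]; last first.
  rewrite mcoeffZ mcoeffX; case: eqVneq => [mE|]; last by rewrite mulr0.
  by rewrite -mE dmon_deg eqxx in md.
by rewrite memN_msupp_eq0 //; apply: contraNN md => /fd ->.
Qed.

Let dpoly_homog d (w : 'rV[k]_d.+1) : dpoly w \is d.-homog.
Proof.
by apply: rpred_sum => i _; apply: rpredZ; rewrite dhomogX /= dmon_deg.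
Qed.

Let dpoly_linear d : linear (@dpoly d).
Proof.
move=> b w w'; rewrite /dpoly scaler_sumr -big_split; apply: eq_bigr => i _ /=.
by rewrite !mxE scalerDl scalerA.
Qed.

Let dcoord_linear d : linear (dcoord d).
Proof. by move=> b f u; apply/rowP => i; rewrite !mxE mcoeffD mcoeffZ. Qed.

Lemma xbar_homog i : (xbar k i : Sh) \is 1.-homog.
Proof.
have Xh (j : 'I_2) : ('X_j : Sh) \is 1.-homog by rewrite dhomogX /= mdeg1.
by case: i => [[|[|[|//]]] hi]; rewrite /xbar /= ?rpredN ?rpredD.
Qed.

Lemma Sh_act_homog g d f : f \is d.-homog -> Sh_act g f \is d.-homog.
Proof.
move=> /dcoordK <-; rewrite Sh_act_sum; apply: rpred_sum => i _.
rewrite Sh_actZ; apply: rpredZ; rewrite /Sh_act comp_mpolyX.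
have tn (j : 'I_2) n :
    tnth [tuple xbar k (g (widen23 l)) | l < 2] j ^+ n \is n.-homog.
  by rewrite tnth_mktuple -[n in n.-homog]mul1n; apply/dhomogMn/xbar_homog.
move: (dmon i) (dmon_deg i) => m; rewrite mdegE => <-.
rewrite !big_ord_recl !big_ord0 mulr1 addn0.
by apply: dhomogM; apply: tn.
Qed.

Lemma sub_rowspace n (Q : 'rV[k]_n -> Prop) :
  Q 0 -> (forall b u v, Q u -> Q v -> Q (b *: u + v)) ->
  exists U : 'M[k]_n, forall u, (u <= U)%MS <-> Q u.
Proof.
move=> Q0 Ql.
have QU m (U : 'M[k]_(m, n)) : (forall i, Q (row i U)) ->
    forall u, (u <= U)%MS -> Q u.
  move=> hU u /submxP [D ->]; rewrite mulmx_sum_row.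
  elim/big_ind: _ => // [v w Qv Qw|i _]; first by rewrite -[v]scale1r; apply: Ql.
  by rewrite -[_ *: _]addr0; apply: Ql.
suff H m : (exists U : 'M[k]_n, (forall i, Q (row i U)) /\ (n - \rank U <= m)%N) ->
    exists U : 'M[k]_n, forall u, (u <= U)%MS <-> Q u.
  apply: (H n); exists 0; split; last exact: leq_subr.
  by move=> i; rewrite row0.
elim: m => [|m IHm] [U [hU rU]].
  exists U => u; split; first exact: QU.
  move=> _; apply: submx_full; rewrite /row_full eqn_leq rank_leq_col.
  by rewrite -subn_eq0 -leqn0.
case: (classic (forall u, Q u -> (u <= U)%MS)) => [full|].
  by exists U => u; split; [exact: QU | exact: full].
move=> /not_all_ex_not [u nu]; have [Qu uU] := imply_to_and _ _ nu.
apply: IHm; exists (U + u)%MS; split.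
  move=> i; apply: (QU _ (col_mx U u)); last by rewrite -addsmxE row_sub.
  move=> j; case: (split_ordP j) => j' ->; first by rewrite rowKu.
  by rewrite rowKd row_id.
have lt : (\rank U < \rank (U + u)%MS)%N.
  apply: rank_ltmx; rewrite ltmxE addsmxSl; apply/negP => UuU; apply: uU.
  exact: submx_trans (addsmxSr U u) UuU.
by rewrite -ltnS; apply: leq_trans rU; apply: ltn_sub2l => //;
   apply: leq_trans lt (rank_leq_col _).
Qed.

Lemma pieceP N d :
  N 0 -> (forall b f u, N f -> N u -> N (b *: f + u)) ->
  (forall g f, N f -> N (Sh_act g f)) -> affords_piece N d (piece N d).
Proof.
move=> N0 Nl Ng; rewrite /piece; apply: epsilon_spec.
have [|b w w' Nw Nw'|U UP] := @sub_rowspace d.+1 (fun w => N (dpoly w)).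
- by rewrite /dpoly big1 // => i _; rewrite mxE scale0r.
- by rewrite dpoly_linear; apply: Nl.
pose R g : 'M[k]_d.+1 := \matrix_i dcoord d (Sh_act g 'X_[dmon i]).
have RE g w : w *m R g = dcoord d (Sh_act g (dpoly w)).
  rewrite mulmx_sum_row /dpoly Sh_act_sum.
  have dc0 : dcoord d 0 = 0 by apply/rowP => i; rewrite !mxE mcoeff0.
  have dcD f u : dcoord d (f + u) = dcoord d f + dcoord d u.
    by have := dcoord_linear d 1 f u; rewrite !scale1r.
  rewrite (big_morph _ dcD dc0); apply: eq_bigr => i _.
  rewrite rowK Sh_actZ -[_ *: Sh_act _ _]addr0 dcoord_linear dc0 addr0 //.
have dR g w : dpoly (w *m R g) = Sh_act g (dpoly w).
  by rewrite RE dcoordK //; apply/Sh_act_homog/dpoly_homog.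
have Rrepr : mx_repr [set: 'S_3] R.
  split=> [|g g' _ _]; apply/row_matrixP => i; rewrite !rowE.
    by rewrite RE Sh_act1 dpolyK mulmx1.
  by rewrite mulmxA !RE Sh_act_comp dcoordK //; apply/Sh_act_homog/dpoly_homog.
pose rR := MxRepresentation Rrepr.
have Umod : mxmodule rR U.
  apply/mxmoduleP => g _; apply/row_subP => i; rewrite row_mul; apply/UP.
  by rewrite dR; apply/Ng/UP; apply: row_sub.
have pil : linear (fun f => in_factmod U (dcoord d f)).
  by move=> b f u; rewrite dcoord_linear linearP.
pose piL := GRing.isLinear.Build k Sh _ _ _ pil.
exists (Representation (factmod_repr Umod)).
exists (HB.pack_for {linear Sh -> 'rV[k]_(\rank (cokermx U))}
  (fun f => in_factmod U (dcoord d f)) piL); split=> /=.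
- move=> w; exists (dpoly (val_factmod w)); first exact: dpoly_homog.
  by rewrite dpolyK val_factmodK.
- move=> f fd; split=> [E|Nf].
    by rewrite -(dcoordK fd); apply/UP; rewrite -in_factmod_eq0 E.
  by apply/eqP; rewrite in_factmod_eq0; apply/UP; rewrite dcoordK.
- move=> g f fd; rewrite -[RHS](@in_factmodJ _ _ _ _ rR) ?inE //=.
  by rewrite RE dcoordK.
Qed.

End GradedPiece.

Section Grothendieck.
Variables (F : fieldType) (gT : finGroupType) (G : {group gT}).
Local Notation grepr := (representation F G).

Definition additive_invariant (A : zmodType) (phi : grepr -> A) : Prop :=
  (forall r1 r2 : grepr, mx_rsim r1 r2 -> phi r1 = phi r2) /\
  (forall n (rG : mx_representation F G n) (U : 'M_n) (Umod : mxmodule rG U),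
     phi (Representation rG) = phi (Representation (submod_repr Umod)) +
                               phi (Representation (factmod_repr Umod))).

(* Formal Z-combinations of representations; [K0_eq] is equality in K_0(G),
   the group through which every additive invariant factors. *)
Definition K0_term := seq (int * grepr).

Definition K0_eq (s1 s2 : K0_term) : Prop :=
  forall (A : zmodType) (phi : grepr -> A), additive_invariant phi ->
    \sum_(x <- s1) phi x.2 *~ x.1 = \sum_(x <- s2) phi x.2 *~ x.1.

Definition K0_class (r : grepr) : K0_term := [:: (1, r)].

Definition K0_add (s1 s2 : K0_term) : K0_term := s1 ++ s2.

Definition K0_opp (s : K0_term) : K0_term := [seq (- x.1, x.2) | x <- s].

Definition K0_mul (s1 s2 : K0_term) : K0_term :=
  [seq (x.1 * y.1, Representation (prod_repr x.2 y.2)) |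
    x : int * grepr <- s1, y : int * grepr <- s2].

(* K_0(G)[[z]] *)
Definition K0_series := nat -> K0_term.

Definition K0s_eq (f g : K0_series) : Prop := forall d, K0_eq (f d) (g d).

Definition K0s_mono (r : grepr) (n : nat) : K0_series :=
  fun d => if d == n then K0_class r else [::].

Definition K0s_add (f g : K0_series) : K0_series :=
  fun d => K0_add (f d) (g d).

Definition K0s_sub (f g : K0_series) : K0_series :=
  fun d => K0_add (f d) (K0_opp (g d)).

Definition K0s_mul (f g : K0_series) : K0_series :=
  fun d => \big[K0_add/[::]]_(i < d.+1) K0_mul (f i) (g (d - i)%N).

End Grothendieck.

Section Reps.
Variable k : fieldType.
Local Notation Sh := {mpoly k[2]}.

Lemma triv_mx_repr : mx_repr [set: 'S_3] (fun _ => 1%:M : 'M[k]_1).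
Proof. by split=> // g g' _ _; rewrite mulmx1. Qed.

Lemma sign_mx_repr : mx_repr [set: 'S_3] (fun g => ((-1) ^+ g)%:M : 'M[k]_1).
Proof.
split=> [|g g' _ _]; first by rewrite odd_perm1 expr0.
by rewrite odd_permM signr_addb scalar_mxM.
Qed.

Definition Triv : representation k [set: 'S_3] :=
  Representation (MxRepresentation triv_mx_repr).

Definition Sign : representation k [set: 'S_3] :=
  Representation (MxRepresentation sign_mx_repr).

(* The character and the Hilbert function of S h^* / N. *)
Definition chi (N : Sh -> Prop) : K0_series k [set: 'S_3] :=
  fun d => K0_class (piece N d).

Definition hilb (N : Sh -> Prop) (d : nat) : nat := rdegree (piece N d).

Definition zero_sub : Sh -> Prop := fun f => f = 0.

Definition max_proper_graded_submodule t c (N : verma t c -> Prop) : Prop :=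
  let proper_graded (N' : verma t c -> Prop) :=
    [/\ submodule N', exists f, ~ N' f &
        forall d (f : Sh), N' f -> N' (pihomog mdeg d f)] in
  proper_graded N /\
  forall N', proper_graded N' -> forall f, N' f -> N f.

Definition sigma2 : Sh :=
  xbar k 0 * xbar k 1 + xbar k 0 * xbar k 2 + xbar k 1 * xbar k 2.
Definition sigma3 : Sh := xbar k 0 * xbar k 1 * xbar k 2.
Definition qdisc : Sh :=
  (xbar k 0 - xbar k 1) * (xbar k 1 - xbar k 2) * (xbar k 0 - xbar k 2).

End Reps.

Section CompleteIntersection.
Variable R : comNzRingType.

Definition in_ideal (r : seq R) (f : R) : Prop :=
  exists a : 'I_(size r) -> R, f = \sum_i a i * r`_i.

Definition regular_sequence (r : seq R) : Prop :=
  ~ in_ideal r 1 /\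
  forall i, (i < size r)%N -> forall f,
    in_ideal (take i r) (f * r`_i) -> in_ideal (take i r) f.

(* R / I is a complete intersection, for a polynomial ring R. *)
Definition complete_intersection (I : R -> Prop) : Prop :=
  exists r, regular_sequence r /\ forall f, I f <-> in_ideal r f.

End CompleteIntersection.

(* Main.v *)
Require Import Defs.
From HB Require Import structures.
From mathcomp Require Import all_boot all_order all_algebra all_fingroup.
From mathcomp Require Import mxrepresentation character.
From mathcomp Require Import mpoly.
From mathcomp Require Import ring zify.

Set Implicit Arguments.
Unset Strict Implicit.
Unset Printing Implicit Defensive.

Import GRing.Theory.
Local Open Scope ring_scope.

(** Write n = 2 c - p = 2 m + 1, so that 2 c = n in k and 3 n < p; let q be the
    discriminant qdisc, v = q ^ n the generator of degree 3 n, w the one of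
    degree p, and J the submodule that they generate.

    J is the ideal (v, w).  An S_3-stable ideal is stable under the Dunkl
    operators once these send its generators into it ([ideal2_submodule]).  On
    an antisymmetric f, the operator D_y satisfies
    q D_y f = q d_y f - 2 c f d_y q ([dunkl_anti]), which vanishes for f = q ^ n
    because 2 c = n in k.  On an invariant f, D_y f is the plain derivative d_y f.
    As the degree p of w is 0 in k, Euler's formula makes dw a multiple of
    the form 2 sigma2 dsigma3 - 3 sigma3 dsigma2, hence of q; the sum that defines w
    is the primitive in sigma3 of (q ^ 2) ^ m, so the remaining factor is a multiple
    of q ^ (n - 1), and D_y w is a multiple of v ([deriv_vec_p]).

    J is a complete intersection.  On the three lines where q vanishes, w
    restricts to a nonzero polynomial, since the sum of
    (-1) ^ j 'C(m, j) / (2 j + 1) is a ratio of integers prime to p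
    ([alternating_binomial_sum], [line_res_vec_p_neq0]).  So w is a nonzerodivisor
    modulo v, and the Koszul complex of (v, w), read degree by degree in K_0, gives the
    character ([phi_piece_shift], [chi_two_generators]); the dimension is itself an
    additive invariant, which gives the Hilbert series.  In particular the
    quotient vanishes above degree 3 n + p - 2.

    J is maximal.  By induction on the degree it is enough that a
    homogeneous f of degree d > 0 which every D_y sends into J is itself in J
    ([singular_J]).  The Euler operator, the sum of the x_i D_(y_i) over a basis,
    acts on f through the sum S of the three transpositions, and S ^ 3 = 9 S; so f
    is in J unless d is 0, 3 c or 6 c in k, that is, in the range that matters, unless
    d is p, (3 n + p) / 2 or 3 n.  In the first two cases sl_2-theory applies
    ([singular_descend]): sigma2 ^ l f is in J for degree reasons, and
    quadratic expressions in the D_y bring sigma2 ^ (l + 1) f back to a nonzero multiple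
    of sigma2 ^ l f.  In degree 3 n, f is modulo J a multiple of its
    antisymmetrization f'; then D_y f' has too small a degree to be a nonzero element of J,
    so that q d_y f' = n f' d_y q for all y, and this forces q ^ n to divide f'
    ([qdiscX_dvd_deriv]). *)

(** * Coordinates and semi-invariants *)

Section Coordinates.
Variable k : fieldType.
Local Notation Sh := {mpoly k[2]}.
Local Notation X := ('X_ord0 : Sh).
Local Notation Y := ('X_ord_max : Sh).
Implicit Types (f u : Sh) (g : 'S_3).

Lemma xbar0E : xbar k 0 = X. Proof. by []. Qed.
Lemma xbar1E : xbar k 1 = Y. Proof. by []. Qed.
Lemma xbar2E : xbar k 2 = - (X + Y). Proof. by []. Qed.

Lemma sum_reflections (V : nmodType) (F : 'I_3 -> 'I_3 -> V) :
  \sum_(i < 3) \sum_(j < 3 | (i < j)%N) F i j = F 0 1 + F 0 2 + F 1 2.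
Proof.
under eq_bigr do rewrite big_mkcond /=.
rewrite !big_ord_recl !big_ord0 /= !addr0 !add0r.
by congr (F _ _ + F _ _ + F _ _); apply/val_inj.
Qed.

Lemma sum_ord3 (V : nmodType) (F : 'I_3 -> V) : \sum_i F i = F 0 + F 1 + F 2.
Proof.
rewrite !big_ord_recl big_ord0 /= addr0 addrA.
by congr (_ + F _ + F _); apply/val_inj.
Qed.

Lemma ord3P (P : 'I_3 -> Prop) : P 0 -> P 1 -> P 2 -> forall i, P i.
Proof.
move=> P0 P1 P2 [[|[|[|//]]] hi].
- by move: P0; congr P; apply: val_inj.
- by move: P1; congr P; apply: val_inj.
- by move: P2; congr P; apply: val_inj.
Qed.

Lemma Sh_act_add g : {morph @Sh_act k g : f u / f + u}.
Proof. by move=> f u; have := Sh_act_linear g 1 f u; rewrite !scale1r. Qed.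

Lemma Sh_deriv0 (y : 'rV[k]_3) : Sh_deriv y 0 = 0.
Proof. by have := Sh_deriv_linear y (-1) 0 0; rewrite !scaleN1r oppr0 addr0 addNr. Qed.

Lemma Sh_deriv_add (y : 'rV[k]_3) : {morph Sh_deriv y : f u / f + u}.
Proof. by move=> f u; have := Sh_deriv_linear y 1 f u; rewrite !scale1r. Qed.

Lemma Sh_deriv_sub (y : 'rV[k]_3) : {morph Sh_deriv y : f u / f - u}.
Proof. by move=> f u; rewrite addrC -scaleN1r Sh_deriv_linear scaleN1r addrC. Qed.

Lemma Sh_derivZ (y : 'rV[k]_3) b f : Sh_deriv y (b *: f) = b *: Sh_deriv y f.
Proof. by have := Sh_deriv_linear y b f 0; rewrite Sh_deriv0 !addr0. Qed.

Lemma Sh_derivX (y : 'rV[k]_3) f n :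
  Sh_deriv y (f ^+ n.+1) = n.+1%:R * (f ^+ n * Sh_deriv y f).
Proof.
elim: n => [|n IHn]; first by rewrite expr0 expr1 !mul1r.
rewrite exprS Sh_derivM IHn [f ^+ n.+1]exprS -[in RHS]natr1.
by move: (Sh_deriv y f) (f ^+ n) n.+1%:R => *; ring.
Qed.

Lemma sigma2E : sigma2 k = - (X ^+ 2 + X * Y + Y ^+ 2).
Proof. by rewrite /sigma2 xbar0E xbar1E xbar2E; ring. Qed.

Lemma sigma3E : sigma3 k = - (X * Y * (X + Y)).
Proof. by rewrite /sigma3 xbar0E xbar1E xbar2E; ring. Qed.

Lemma qdiscE : qdisc k = (X - Y) * (X + 2%:R * Y) * (2%:R * X + Y).
Proof. by rewrite /qdisc xbar0E xbar1E xbar2E; ring. Qed.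

Lemma qdisc_sqr :
  qdisc k ^+ 2 = (- 4%:R) *: sigma2 k ^+ 3 + (- 27%:R) *: sigma3 k ^+ 2.
Proof.
by rewrite !scaleNr !scaler_nat qdiscE sigma2E sigma3E; ring.
Qed.

Lemma Sh_act_tperm_sigma i j : i != j ->
  [/\ Sh_act (tperm i j) (sigma2 k) = sigma2 k,
      Sh_act (tperm i j) (sigma3 k) = sigma3 k &
      Sh_act (tperm i j) (qdisc k) = - qdisc k].
Proof.
rewrite /sigma2 /sigma3 /qdisc !(Sh_actM, Sh_actB) !Sh_act_add !Sh_actM.
rewrite !Sh_act_xbar.
by rewrite !permE /=; elim/ord3P: i; elim/ord3P: j => //= _; split; ring.
Qed.

Lemma perm_tperm_ind (T : finType) (P : {perm T} -> Prop) :
  P 1%g -> (forall i j s, i != j -> P s -> P (tperm i j * s)%g) -> forall s, P s.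
Proof.
move=> P1 PM s; have [ts -> ] := prod_tpermP s.
elim: ts => [|t ts IHts] /=; first by rewrite big_nil.
by case/andP=> tn /IHts; rewrite big_cons; apply: PM.
Qed.

(** The one-dimensional characters of S_3: b tells the sign from the trivial
    one.  Only transpositions occur in the Dunkl operators, so these are what the
    definition tests. *)
Definition semi_invariant (b : bool) f :=
  forall i j, i != j -> Sh_act (tperm i j) f = (-1) ^+ b *: f.

Lemma semi_invariantP b f g :
  semi_invariant b f -> Sh_act g f = (-1) ^+ (b && odd_perm g) *: f.
Proof.
move=> fP; elim/perm_tperm_ind: g => [|i j g ij IHg].
  by rewrite Sh_act1 odd_perm1 andbF scale1r.
rewrite Sh_act_comp fP // Sh_actZ IHg scalerA -signr_addb odd_permM odd_tperm ij.
by case: b {fP IHg}.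
Qed.

Lemma semi_invariantM b b' f u :
  semi_invariant b f -> semi_invariant b' u -> semi_invariant (b (+) b') (f * u).
Proof.
move=> fP uP i j ij; rewrite Sh_actM fP // uP // -scalerAl -scalerAr scalerA.
by rewrite signr_addb.
Qed.

Lemma semi_invariantX b f n :
  semi_invariant b f -> semi_invariant (odd n && b) (f ^+ n).
Proof.
move=> fP; elim: n => [|n IHn] i j ij; first by rewrite expr0 Sh_act_one scale1r.
rewrite exprS (semi_invariantM fP IHn) //=; congr (_ ^+ _ *: _).
by case: b {fP IHn} => //; case: (odd n).
Qed.

Lemma semi_invariant_sigma2 : semi_invariant false (sigma2 k).
Proof. by move=> i j ij; have [-> _ _] := Sh_act_tperm_sigma ij; rewrite scale1r. Qed.

Lemma semi_invariant_sigma3 : semi_invariant false (sigma3 k).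
Proof. by move=> i j ij; have [_ -> _] := Sh_act_tperm_sigma ij; rewrite scale1r. Qed.

Lemma semi_invariant_qdisc : semi_invariant true (qdisc k).
Proof. by move=> i j ij; have [_ _ ->] := Sh_act_tperm_sigma ij; rewrite scaleN1r. Qed.

Lemma sigma2_homog : sigma2 k \is 2.-homog.
Proof. by rewrite !rpredD // -[2%N]/(1 + 1)%N dhomogM ?xbar_homog. Qed.

Lemma sigma3_homog : sigma3 k \is 3.-homog.
Proof. by rewrite -[3%N]/(1 + 1 + 1)%N !dhomogM ?xbar_homog. Qed.

Lemma qdisc_homog : qdisc k \is 3.-homog.
Proof. by rewrite -[3%N]/(1 + 1 + 1)%N !dhomogM ?rpredB ?xbar_homog. Qed.

(** * Dunkl operators on semi-invariants *)

Lemma dunkl3E t c y f :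
  dunkl t c y f = t *: Sh_deriv y f -
    ((c * (y 0 0 - y 0 1)) *: divdiff 0 1 f +
     (c * (y 0 0 - y 0 2)) *: divdiff 0 2 f +
     (c * (y 0 1 - y 0 2)) *: divdiff 1 2 f).
Proof. by rewrite /dunkl sum_reflections !pairing_root. Qed.

(** Divided differences are linear over the invariants, so only the
    derivation sees an invariant factor. *)
Lemma dunkl_invM c y f u : semi_invariant false f ->
  dunkl 1 c y (f * u) = f * dunkl 1 c y u + Sh_deriv y f * u.
Proof.
move=> fP; have dd i j : i != j -> divdiff i j (f * u) = f * divdiff i j u.
  move=> ij; apply: divdiff_uniq => //.
  by rewrite -mulrA divdiffP Sh_actM fP // scale1r mulrBr.
rewrite !dunkl3E !scale1r Sh_derivM !dd // -!mul_mpolyC.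
move: (divdiff 0 1 u) (divdiff 0 2 u) (divdiff 1 2 u) (Sh_deriv y f).
by move: (Sh_deriv y u) => *; ring.
Qed.

Lemma dunkl_inv c y f : semi_invariant false f -> dunkl 1 c y f = Sh_deriv y f.
Proof.
by move=> fP; rewrite -[f]mulr1 dunkl_invM // dunkl1 mulr0 add0r !mulr1.
Qed.

(** On an antisymmetric f the divided difference along x_i - x_j is
    2 f / (x_i - x_j), and the sum of these quotients is a logarithmic
    derivative of q. *)
Lemma dunkl_anti c y f : in_h y -> semi_invariant true f ->
  qdisc k * dunkl 1 c y f =
  qdisc k * Sh_deriv y f - (2%:R * c) *: (f * Sh_deriv y (qdisc k)).
Proof.
move=> hy fP; have dd i j : i != j -> divdiff i j f * (xbar k i - xbar k j) = 2%:R * f.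
  by move=> ij; rewrite divdiffP fP // scaleN1r opprK mulr_natl mulr2n.
have E01 : qdisc k * divdiff 0 1 f =
    2%:R * f * ((xbar k 1 - xbar k 2) * (xbar k 0 - xbar k 2)).
  by rewrite -(dd 0 1) // /qdisc; ring.
have E02 : qdisc k * divdiff 0 2 f =
    2%:R * f * ((xbar k 0 - xbar k 1) * (xbar k 1 - xbar k 2)).
  by rewrite -(dd 0 2) // /qdisc; ring.
have E12 : qdisc k * divdiff 1 2 f =
    2%:R * f * ((xbar k 0 - xbar k 1) * (xbar k 0 - xbar k 2)).
  by rewrite -(dd 1 2) // /qdisc; ring.
have -> : Sh_deriv y (qdisc k) = Sh_deriv y ((xbar k 0 - xbar k 1) *
  (xbar k 1 - xbar k 2) * (xbar k 0 - xbar k 2)) by [].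
rewrite !Sh_derivM !Sh_deriv_sub !Sh_deriv_xbar // dunkl3E scale1r.
rewrite -!mul_mpolyC !rmorphM !rmorphB rmorph_nat /=.
move: (Sh_deriv y f) (divdiff 0 1 f) (divdiff 0 2 f) (divdiff 1 2 f) E01 E02 E12.
move: (xbar k 0) (xbar k 1) (xbar k 2) => x0 x1 x2 D d01 d02 d12.
move: (qdisc k) c%:MP (y 0 0)%:MP (y 0 1)%:MP (y 0 2)%:MP => q c' y0 y1 y2 E01 E02 E12.
rewrite [LHS](_ : _ = q * D - c' * ((y0 - y1) * (q * d01) +
  (y0 - y2) * (q * d02) + (y1 - y2) * (q * d12))); last by ring.
by rewrite E01 E02 E12; ring.
Qed.

Lemma dunkl_qdiscX c y n : in_h y -> odd n -> 2%:R * c = n%:R ->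
  dunkl 1 c y (qdisc k ^+ n) = 0.
Proof.
move=> hy n_odd cn; have derivX : Sh_deriv y (qdisc k ^+ n) * qdisc k =
    n%:R * (qdisc k ^+ n * Sh_deriv y (qdisc k)).
  case: n n_odd {cn} => // n _; rewrite Sh_derivX exprS.
  by move: (Sh_deriv y (qdisc k)) (qdisc k) (_ ^+ n) n.+1%:R => *; ring.
have q0 : qdisc k != 0 by rewrite !mulf_neq0 ?xbar_neq.
apply: (mulfI q0); rewrite mulr0 dunkl_anti //; last first.
  by have := semi_invariantX n semi_invariant_qdisc; rewrite n_odd.
by rewrite cn mulrC derivX scaler_nat mulr_natl subrr.
Qed.

End Coordinates.

(** * The generator of degree p *)

Section DegreeP.
Variable k : fieldType.
Local Notation Sh := {mpoly k[2]}.
Local Notation X := ('X_ord0 : Sh).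
Local Notation Y := ('X_ord_max : Sh).
Implicit Types (f u : Sh) (g : 'S_3).

Lemma in_h_coord2 (y : 'rV[k]_3) : in_h y -> y 0 2 = - (y 0 0 + y 0 1).
Proof. by rewrite /in_h sum_ord3 addrC => /eqP; rewrite addr_eq0 => /eqP. Qed.

Lemma Sh_deriv_sigma2 (y : 'rV[k]_3) : in_h y -> Sh_deriv y (sigma2 k) =
  - ((y 0 0)%:MP * (2%:R * X + Y) + (y 0 1)%:MP * (X + 2%:R * Y)).
Proof.
move=> hy; have -> : Sh_deriv y (sigma2 k) = Sh_deriv y (xbar k 0 * xbar k 1 +
  xbar k 0 * xbar k 2 + xbar k 1 * xbar k 2) by [].
rewrite !Sh_deriv_add !Sh_derivM !Sh_deriv_xbar // in_h_coord2 // rmorphN rmorphD /=.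
rewrite xbar0E xbar1E xbar2E.
by move: X Y (y 0 0)%:MP (y 0 1)%:MP => x1 x2 y0 y1; ring.
Qed.

(** On the line where two coordinates agree, dsigma2 and dsigma3 are
    proportional by symmetry, and Euler's formula finds their ratio; so this
    combination is divisible by q. *)
Lemma deriv_sigma_qdisc (y : 'rV[k]_3) : in_h y ->
  2%:R * sigma2 k * Sh_deriv y (sigma3 k) - 3%:R * sigma3 k * Sh_deriv y (sigma2 k)
  = qdisc k * ((y 0 1)%:MP * X - (y 0 0)%:MP * Y).
Proof.
move=> hy; have -> : Sh_deriv y (sigma3 k) =
  Sh_deriv y (xbar k 0 * xbar k 1 * xbar k 2) by [].
rewrite Sh_deriv_sigma2 // !Sh_derivM !Sh_deriv_xbar // in_h_coord2 // rmorphN rmorphD /=.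
rewrite sigma2E sigma3E qdiscE xbar0E xbar1E xbar2E.
by move: X Y (y 0 0)%:MP (y 0 1)%:MP => x1 x2 y0 y1; ring.
Qed.

(** The derivative of a monomial in sigma2 and sigma3 whose degree vanishes
    in k is, by Euler's formula, a multiple of a single 1-form. *)
Lemma deriv_sigma_monomial (y : 'rV[k]_3) a b :
  (2 * a.+1 + 3 * b.+1)%:R = 0 :> k -> in_h y ->
  2%:R * Sh_deriv y (sigma2 k ^+ a.+1 * sigma3 k ^+ b.+1) =
  b.+1%:R * (sigma2 k ^+ a * sigma3 k ^+ b) *
    (qdisc k * ((y 0 1)%:MP * X - (y 0 0)%:MP * Y)).
Proof.
move=> ab hy; rewrite -deriv_sigma_qdisc // Sh_derivM !Sh_derivX.
have : (2%:R * a.+1%:R + 3%:R * b.+1%:R : Sh) = 0.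
  by rewrite -!natrM -natrD -mpolyC_nat ab mpolyC0.
move/eqP; rewrite addr_eq0 => /eqP E; rewrite 2![in LHS]exprS.
move: (Sh_deriv y _) (Sh_deriv y _) a.+1%:R b.+1%:R E => d3 d2 a1 b1 E.
move: (sigma2 k) (sigma3 k) (_ ^+ a) (_ ^+ b) => s2 s3 s2a s3b.
rewrite [LHS](_ : _ = (2%:R * a1) * (s2a * d2 * (s3 * s3b)) +
   2%:R * b1 * (s2 * s2a * (s3b * d3))); last by ring.
by rewrite E; ring.
Qed.

(** With exponents e = 2 p - 3 c and m = c - (p + 1) / 2, for which the degree
    2 e + 6 m + 3 is p. *)
Definition vec_p (e m : nat) : Sh :=
  sigma2 k ^+ e * sigma3 k *
    \sum_(0 <= j < m.+1)
      ('C(m, j)%:R / (2 * j + 1)%:R) *: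
        (((- 4%:R) *: sigma2 k ^+ 3) ^+ (m - j) *
         ((- 27%:R) *: sigma3 k ^+ 2) ^+ j).

Lemma vec_pE e m : vec_p e m = \sum_(j < m.+1)
  ('C(m, j)%:R / (2 * j).+1%:R * (- 4%:R) ^+ (m - j) * (- 27%:R) ^+ j) *:
    (sigma2 k ^+ (e + 3 * (m - j)) * sigma3 k ^+ (2 * j).+1).
Proof.
rewrite /vec_p big_mkord mulr_sumr; apply: eq_bigr => j _.
rewrite !exprZn -scalerAl -!scalerAr !scalerA addn1.
by congr (_ *: _); rewrite -!exprM exprD mulrACA -exprS.
Qed.

(** Term by term the factors 2 j + 1 cancel, and the binomial theorem sums
    the result to a power of q. *)
Lemma deriv_vec_p (y : 'rV[k]_3) e m :
  (2 * e.+1 + 6 * m + 3)%:R = 0 :> k ->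
  (forall j, (j <= m)%N -> (2 * j).+1%:R != 0 :> k) -> in_h y ->
  2%:R * Sh_deriv y (vec_p e.+1 m) =
  qdisc k ^+ (2 * m).+1 * (sigma2 k ^+ e * ((y 0 1)%:MP * X - (y 0 0)%:MP * Y)).
Proof.
move=> em jm hy; rewrite vec_pE (big_morph _ (Sh_deriv_add y) (Sh_deriv0 y)) mulr_sumr.
rewrite exprS exprM qdisc_sqr exprDn mulr_sumr mulr_suml; apply: eq_bigr => j _.
rewrite Sh_derivZ -scalerAr addSn deriv_sigma_monomial //; last first.
  rewrite -em; congr (_%:R); have := ltn_ord j; lia.
rewrite !exprZn -!scalerAl -!scalerAr.
have := jm j (ltn_ord j); set n : k := _.+1%:R => n0.
have -> f : (2 * j).+1%:R * f = n *: f by rewrite scaler_nat mulr_natl.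
rewrite -scaler_nat -!scalerAl !scalerA -!scalerAr -!scalerAl.
congr (_ *: _).
  by rewrite 2!(mulrAC _ _ n) divfK.
by rewrite (exprD _ e) -!exprM [LHS](AC (3*2) (4*(2*3)*(1*5))).
Qed.

Lemma vec_p_homog e m : vec_p e m \is (2 * e + 6 * m + 3)%N.-homog.
Proof.
rewrite vec_pE; apply: rpred_sum => j _; apply: rpredZ.
have -> : (2 * e + 6 * m + 3 = 2 * (e + 3 * (m - j)) + 3 * (2 * j).+1)%N.
  have := ltn_ord j; lia.
by apply: dhomogM; apply: dhomogMn; [exact: sigma2_homog | exact: sigma3_homog].
Qed.

Lemma semi_invariant_vec_p e m : semi_invariant false (vec_p e m).
Proof.
move=> i j ij; rewrite vec_pE Sh_act_sum scaler_sumr; apply: eq_bigr => l _.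
rewrite Sh_actZ scale1r; congr (_ *: _).
have s2 := semi_invariantX (e + 3 * (m - l)) (semi_invariant_sigma2 k).
have s3 := semi_invariantX (2 * l).+1 (semi_invariant_sigma3 k).
by have := semi_invariantM s2 s3 ij; rewrite !andbF /= scale1r.
Qed.

End DegreeP.

(** * The lines on which the discriminant vanishes *)

Section Walls.
Variable k : fieldType.
Local Notation Sh := {mpoly k[2]}.
Local Notation X := ('X_ord0 : Sh).
Local Notation Y := ('X_ord_max : Sh).
Implicit Types (f u : Sh) (b : k).
Hypotheses (two_neq0 : 2%:R != 0 :> k) (three_neq0 : 3%:R != 0 :> k).

(** Restriction to the line Y = b X, kept inside Sh: the restricted polynomials
    are the ones in X only, and Sh is already known to be a domain. *)
Definition line_res b f : Sh := f \mPo [tuple X; b *: X].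

Lemma line_resM b : {morph line_res b : f u / f * u}.
Proof. by move=> f u; rewrite /line_res rmorphM. Qed.

Lemma line_resD b : {morph line_res b : f u / f + u}.
Proof. by move=> f u; rewrite /line_res rmorphD. Qed.

Lemma line_resN b : {morph line_res b : f / - f}.
Proof. by move=> f; rewrite /line_res rmorphN. Qed.

Lemma line_resZ b a f : line_res b (a *: f) = a *: line_res b f.
Proof. by rewrite /line_res linearZ. Qed.

Lemma line_resXn b f n : line_res b (f ^+ n) = line_res b f ^+ n.
Proof. by rewrite /line_res rmorphXn. Qed.

Lemma line_res_sum b (I : Type) (r : seq I) (P : pred I) (F : I -> Sh) :
  line_res b (\sum_(i <- r | P i) F i) = \sum_(i <- r | P i) line_res b (F i).
Proof. by rewrite /line_res rmorph_sum. Qed.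

Lemma line_resX b : line_res b X = X.
Proof. by rewrite /line_res comp_mpolyXU. Qed.

Lemma line_resY b : line_res b Y = b *: X.
Proof. by rewrite /line_res comp_mpolyXU. Qed.

Definition line_resE := (line_resM, line_resD, line_resN, line_resZ, line_resXn,
  line_resX, line_resY).

Lemma line_res_sub b f : exists u, f - line_res b f = u * (Y - b *: X).
Proof.
elim/Sh_ind: f => [|a f u [f' fE] [u' uE]|i f [f' fE]].
- by exists 0; rewrite /line_res rmorph1 subrr mul0r.
- exists (a *: f' + u'); rewrite line_resD line_resZ mulrDl -scalerAl -fE -uE.
  by rewrite scalerBr opprD addrACA.
have [l lE] : exists l, xbar k i - line_res b (xbar k i) = l * (Y - b *: X).
  elim/ord3P: i; rewrite ?xbar0E ?xbar1E ?xbar2E !line_resE.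
  - by exists 0; rewrite subrr mul0r.
  - by exists 1; rewrite mul1r.
  by exists (-1); rewrite -mul_mpolyC; ring.
exists (xbar k i * f' + l * line_res b f).
rewrite line_resM mulrDl -mulrA -fE [l * _]mulrC -mulrA -lE.
by move: (line_res b f) (line_res b _) (xbar k i) => *; ring.
Qed.

Lemma line_res_eq0 b f : line_res b f = 0 -> exists u, f = u * (Y - b *: X).
Proof. by have [u] := line_res_sub b f => + f0; rewrite f0 subr0; exists u. Qed.

(** The slopes of the lines x_1 = x_2, x_2 = x_3 and x_1 = x_3, where
    x_3 = - (X + Y). *)
Definition walls : seq k := [:: 1; - 2%:R^-1; - 2%:R].

Lemma X_neq0 : X != 0.
Proof. by rewrite -msize_poly_eq0 msizeX. Qed.

Lemma qdisc_walls :
  qdisc k = - 2%:R *: (\prod_(b <- walls) (Y - b *: X)).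
Proof.
have h2 : 2%:R * (2%:R^-1)%:MP = 1 :> Sh by rewrite -mpolyC_nat -mpolyCM divff.
rewrite qdiscE !big_cons big_nil mulr1 -!mul_mpolyC.
rewrite mpolyC1 !mpolyCN mpolyC_nat; move: (2%:R^-1)%:MP h2 => h h2.
rewrite [RHS](_ : _ = (X - Y) * (2%:R * h * X + 2%:R * Y) * (2%:R * X + Y)).
  by rewrite h2 mul1r.
by ring.
Qed.

Lemma wallP (P : k -> Prop) : P 1 -> P (- 2%:R^-1) -> P (- 2%:R) ->
  forall b, b \in walls -> P b.
Proof. by move=> P1 P2 P3 b; rewrite !inE => /or3P[] /eqP ->. Qed.

Lemma walls_uniq : uniq walls.
Proof.
have h2 : 2%:R * 2%:R^-1 = 1 :> k by rewrite divff.
have inj2 (x y : k) : 2%:R * (x - y) != 0 -> x != y.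
  by rewrite mulf_eq0 negb_or subr_eq0 => /andP[].
rewrite /= !inE negb_or andbT -andbA; move: 2%:R^-1 h2 => h h2.
apply/and3P; split; apply: inj2.
- by rewrite [X in X != 0](_ : _ = 2%:R + 2%:R * h); [rewrite h2 -(natrD _ 2 1)|ring].
- rewrite [X in X != 0](_ : _ = 2%:R * 3%:R) ?mulf_neq0 //; ring.
- rewrite [X in X != 0](_ : _ = 4%:R - 2%:R * h); last by ring.
  by rewrite h2 [X in X != 0](_ : _ = 3%:R) //; ring.
Qed.

Lemma dvd_walls (s : seq k) f : uniq s ->
  (forall b, b \in s -> line_res b f = 0) ->
  exists u, f = u * \prod_(b <- s) (Y - b *: X).
Proof.
elim: s f => [|b s IHs] f /= => [_ _|/andP[bs us] f0].
  by exists f; rewrite big_nil mulr1.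
have [u uE] := line_res_eq0 (f0 b (mem_head _ _)).
have [b' b's|v vE] := IHs u us.
  have := f0 b'; rewrite inE b's orbT => /(_ isT); rewrite uE !line_resE.
  rewrite -scalerBl => /eqP; rewrite mulf_eq0 => /orP[/eqP //|].
  rewrite scaler_eq0 subr_eq0 (negPf X_neq0) orbF => /eqP b'b.
  by rewrite -b'b b's in bs.
by exists v; rewrite uE vE big_cons mulrAC mulrA.
Qed.

(** The walls meet only at the origin, so vanishing on all of them is
    divisibility by the discriminant. *)
Lemma qdisc_dvdP f :
  (forall b, b \in walls -> line_res b f = 0) <-> exists u, f = qdisc k * u.
Proof.
split=> [f0|[u ->] b bw].
  have [u ->] := dvd_walls walls_uniq f0; exists ((- 2%:R)^-1 *: u).
  rewrite qdisc_walls -scalerAl -scalerAr scalerA divff ?oppr_eq0 //.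
  by rewrite scale1r mulrC.
rewrite qdisc_walls line_resM line_resZ (big_rem b bw) /= line_resM.
by rewrite !line_resE subrr mul0r scaler0 mul0r.
Qed.

Lemma qdisc_neq0 : qdisc k != 0.
Proof. by rewrite !mulf_neq0 ?xbar_neq. Qed.

(** The linear factors of q are primes that do not divide v. *)
Lemma qdiscX_dvd_mul n f v :
  (forall b, b \in walls -> line_res b v != 0) ->
  (exists u, f * v = qdisc k ^+ n * u) -> exists u, f = qdisc k ^+ n * u.
Proof.
move=> v0; elim: n f => [|n IHn] f [u uE]; first by exists f; rewrite mul1r.
have [b bw|f' fE] := (qdisc_dvdP f).1.
  apply: (mulIf (v0 b bw)); rewrite -line_resM uE exprS -mulrA mul0r.
  by apply: (qdisc_dvdP _).2 => //; exists (qdisc k ^+ n * u).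
have [|u' uE'] := IHn f'; last by exists u'; rewrite fE uE' exprS mulrA.
exists u; apply: (mulfI qdisc_neq0).
by rewrite !mulrA -fE uE exprS.
Qed.

(** The three linear factors of q are distinct, so dq does not vanish
    identically on any of the lines. *)
Lemma line_res_deriv_qdisc b : b \in walls ->
  line_res b (Sh_deriv (basis3 k 0 - basis3 k 2) (qdisc k)) != 0.
Proof.
have hy : in_h (basis3 k 0 - basis3 k 2) := in_h_root _ _ _.
have Dq y : Sh_deriv y (qdisc k) = Sh_deriv y ((xbar k 0 - xbar k 1) *
  (xbar k 1 - xbar k 2) * (xbar k 0 - xbar k 2)) by [].
rewrite Dq !Sh_derivM !Sh_deriv_sub !Sh_deriv_xbar //; move: hy Dq => _ _.
have -> : (basis3 k 0 - basis3 k 2) 0 0 = 1 by rewrite !mxE /= subr0.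
have -> : (basis3 k 0 - basis3 k 2) 0 1 = 0 by rewrite !mxE /= subr0.
have -> : (basis3 k 0 - basis3 k 2) 0 2 = -1 by rewrite !mxE /= sub0r.
rewrite xbar0E xbar1E xbar2E mpolyCN mpolyC0 mpolyC1 => bw.
set D := (X in line_res b X).
have -> : line_res b D = (3%:R * (2%:R + 2%:R * b - b ^+ 2)) *: X ^+ 2.
  rewrite [D](_ : _ = 3%:R * (2%:R * X ^+ 2 + 2%:R * (X * Y) - Y ^+ 2)); last first.
    by rewrite /D; ring.
  rewrite -!scaler_nat -!scalerAl !mul1r !line_resE.
  by rewrite -!mul_mpolyC !(rmorphM, rmorphB, rmorphD, rmorphXn, rmorph_nat) /=; ring.
rewrite scaler_eq0 negb_or expf_neq0 ?X_neq0 // andbT mulf_neq0 //.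
have h2 : 2%:R * 2%:R^-1 = 1 :> k by rewrite divff.
move: b bw {D}; apply: wallP.
- by rewrite [X in X != 0](_ : _ = 3%:R) //; ring.
- rewrite -(mulrI_eq0 _ (mulfI two_neq0)) -(mulrI_eq0 _ (mulfI two_neq0)).
  rewrite [X in X == 0](_ : _ = 3%:R) //.
  move: 2%:R^-1 h2 => h h2.
  rewrite [LHS](_ : _ = 8%:R - 4%:R * (2%:R * h) - (2%:R * h) ^+ 2); last by ring.
  by rewrite h2; ring.
- rewrite [X in X != 0](_ : _ = - (2%:R * 3%:R)) ?oppr_eq0 ?mulf_neq0 //; ring.
Qed.

End Walls.

Section Coprimality.
Variable k : fieldType.
Local Notation Sh := {mpoly k[2]}.
Local Notation X := ('X_ord0 : Sh).
Local Notation Y := ('X_ord_max : Sh).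
Implicit Types (f u : Sh) (b : k).

(** The partial fraction expansion of 2 ^ m m! / (x (x + 2) ... (x + 2 m)). *)
Lemma alternating_binomial_sum m (x : k) :
  (forall i, (i <= m)%N -> x + (2 * i)%:R != 0) ->
  (\sum_(j < m.+1) 'C(m, j)%:R * (-1) ^+ j / (x + (2 * j)%:R)) *
    \prod_(i < m.+1) (x + (2 * i)%:R) = (2 ^ m * m`!)%:R.
Proof.
elim: m x => [|m IHm] x x0.
  by rewrite !big_ord1 !mul1r mulVf // x0.
pose F n z := \sum_(j < n.+1) 'C(n, j)%:R * (-1) ^+ j / (z + (2 * j)%:R) : k.
pose P n z := \prod_(i < n.+1) (z + (2 * i)%:R) : k.
rewrite -/(F m.+1 x) -/(P m.+1 x).
(* Pascal's rule turns the sum into a finite difference. *)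
have FS : F m.+1 x = F m x - F m (x + 2%:R).
  pose G j : k := (-1) ^+ j / (x + (2 * j)%:R).
  have FG n : F n x = \sum_(j < n.+1) 'C(n, j)%:R * G j.
    by apply: eq_bigr => j _; rewrite mulrA.
  have -> : F m (x + 2%:R) = - \sum_(j < m.+1) 'C(m, j)%:R * G j.+1.
    rewrite -sumrN; apply: eq_bigr => j _; rewrite /G mulnS natrD exprS.
    by rewrite mulN1r mulNr mulrN opprK mulrA -addrA.
  rewrite !FG opprK big_ord_recl /= bin0 mul1r.
  under eq_bigr => j _ do rewrite /bump add1n binS natrD mulrDl.
  rewrite big_split /= addrA; congr (_ + _).
  have <- : \sum_(j < m.+2) 'C(m, j)%:R * G j = \sum_(j < m.+1) 'C(m, j)%:R * G j.
    by rewrite big_ord_recr /= bin_small // mul0r addr0.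
  by rewrite [RHS]big_ord_recl /= bin0 mul1r.
have P1 : P m.+1 x = x * P m (x + 2%:R).
  rewrite /P big_ord_recl muln0 addr0; congr (_ * _); apply: eq_bigr => i _.
  by rewrite lift0 mulnS (natrD _ 2) addrA.
have P2 : P m.+1 x = P m x * (x + (2 * m.+1)%:R) by rewrite /P big_ord_recr.
have E1 := IHm x (fun i im => x0 i (leqW im)).
have E2 : F m (x + 2%:R) * P m (x + 2%:R) = (2 ^ m * m`!)%:R.
  by apply: IHm => i im; rewrite -addrA -natrD -mulnS x0.
rewrite FS mulrBl {1}P2 P1 mulrA E1 mulrCA E2 [x * _]mulrC -mulrBr addrC addKr.
by rewrite -natrM factS expnS; congr (_%:R); lia.
Qed.

Lemma line_res_sigma b :
  line_res b (sigma2 k) = (- (1 + b + b ^+ 2)) *: X ^+ 2 /\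
  line_res b (sigma3 k) = (- (b * (1 + b))) *: X ^+ 3.
Proof.
rewrite sigma2E sigma3E !line_resE -!mul_mpolyC.
by split; rewrite !(rmorphN, rmorphD, rmorphM, rmorphXn, rmorph1) /=; ring.
Qed.

Hypotheses (two_neq0 : 2%:R != 0 :> k) (three_neq0 : 3%:R != 0 :> k).

Lemma line_res_sigma_neq0 b : b \in walls k ->
  line_res b (sigma2 k) != 0 /\ line_res b (sigma3 k) != 0.
Proof.
have [-> ->] := line_res_sigma b.
rewrite !scaler_eq0 !oppr_eq0 !expf_eq0 !(negPf (X_neq0 _)) !andbF !orbF => bw.
have h2 : 2%:R * 2%:R^-1 = 1 :> k by rewrite divff.
have i2 : 2%:R^-1 != 0 :> k by rewrite invr_eq0.
move: b bw; apply: wallP; move: 2%:R^-1 h2 i2 => h h2 i2.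
- split; first by rewrite [X in X == 0](_ : _ = 3%:R) //; ring.
  by rewrite [X in X == 0](_ : _ = 2%:R) //; ring.
- split.
    rewrite -(mulrI_eq0 _ (mulfI two_neq0)) -(mulrI_eq0 _ (mulfI two_neq0)).
    rewrite [X in X == 0](_ : _ = 4%:R - 2%:R * (2%:R * h) + (2%:R * h) ^+ 2).
      by rewrite h2 [X in X == 0](_ : _ = 3%:R) //; ring.
    by ring.
  rewrite mulf_neq0 ?oppr_eq0 // -(mulrI_eq0 _ (mulfI two_neq0)) mulrBr h2.
  by rewrite mulr1 [X in X == 0](_ : _ = 1) ?oner_eq0 //; ring.
- split; first by rewrite [X in X == 0](_ : _ = 3%:R) //; ring.
  by rewrite [X in X == 0](_ : _ = 2%:R) //; ring.
Qed.

(** On these lines q = 0 makes - 27 sigma3 ^ 2 equal to 4 sigma2 ^ 3, so the sum in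
    w becomes a power of sigma2 times an alternating binomial sum. *)
Lemma line_res_vec_p_neq0 b e m : b \in walls k ->
  (forall j, (j <= m)%N -> (2 * j).+1%:R != 0 :> k) -> (2 ^ m * m`!)%:R != 0 :> k ->
  line_res b (vec_p k e m) != 0.
Proof.
move=> bw jm m0; have [s2 s3] := line_res_sigma_neq0 bw.
have q0 : line_res b (qdisc k) = 0.
  by apply: (qdisc_dvdP two_neq0 three_neq0 _).2 => //; exists 1; rewrite mulr1.
have := congr1 (line_res b) (qdisc_sqr k).
rewrite line_resXn q0 expr0n line_resD => /esym/eqP; rewrite addrC addr_eq0 => /eqP E.
set A := line_res b (_ *: sigma2 k ^+ 3) in E.
have A0 : A != 0 by rewrite /A line_resZ scaler_eq0 oppr_eq0 (natrM _ 2 2) mulf_eq0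
  !(negPf two_neq0) line_resXn expf_neq0.
rewrite /vec_p 2!line_resM line_resXn big_mkord line_res_sum.
rewrite (eq_bigr (fun j : 'I_m.+1 =>
    ('C(m, j)%:R * (-1) ^+ j / (1 + (2 * j)%:R)) *: A ^+ m)) => [|j _].
  rewrite -scaler_suml; apply: mulf_neq0.
    by apply: mulf_neq0 => //; apply: expf_neq0.
  rewrite scaler_eq0 expf_eq0 (negPf A0).
  rewrite andbF orbF; apply: contra_neq m0 => S0.
  by rewrite -(alternating_binomial_sum (x := 1)) ?S0 ?mul0r // => i im; rewrite nat1r jm.
rewrite line_resZ line_resM !(line_resXn _ (_ *: _)) -/A E.
rewrite -scaleN1r exprZn -scalerAr -exprD subnK -1?ltnS // scalerA mulrAC addn1 nat1r //.
Qed.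

(** The hypothesis says that f / q ^ n has zero derivative.  If f = q ^ j u with j < n,
    it reads q d_y u = (n - j) u d_y q, so that u vanishes wherever q does. *)
Lemma qdiscX_dvd_deriv n f :
  (forall j, (0 < j <= n)%N -> j%:R != 0 :> k) ->
  (forall y, in_h y -> qdisc k * Sh_deriv y f = n%:R * (f * Sh_deriv y (qdisc k))) ->
  exists u, f = qdisc k ^+ n * u.
Proof.
move=> n0 fP; suff H j : (j <= n)%N -> exists u, f = qdisc k ^+ j * u by exact: H.
elim: j => [|j IHj] jn; first by exists f; rewrite mul1r.
have [u uE] := IHj (ltnW jn).
have q0 : qdisc k ^+ j != 0 by rewrite expf_neq0 ?qdisc_neq0.
have uP y : in_h y ->
    qdisc k * Sh_deriv y u = (n - j)%:R * (u * Sh_deriv y (qdisc k)).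
  move=> hy; apply: (mulfI q0); have := fP y hy; rewrite uE Sh_derivM natrB 1?ltnW //.
  case: j {IHj jn uE} q0 => [|j] q0.
    by rewrite expr0 Sh_deriv1 mul0r add0r subr0 !mul1r.
  rewrite Sh_derivX exprS; move: (Sh_deriv y (qdisc k)) (Sh_deriv y u) => dq du.
  move: (qdisc k) (_ ^+ j) => q qj E.
  rewrite [LHS](_ : _ = q * (j.+1%:R * (qj * dq) * u + q * qj * du) -
    j.+1%:R * (q * qj * u * dq)); last by ring.
  by rewrite E; ring.
have [b bw|u' u'E] := (qdisc_dvdP two_neq0 three_neq0 u).1; last first.
  by exists u'; rewrite uE u'E exprSr mulrA.
have hy := in_h_root k 0 2; have := congr1 (line_res b) (uP _ hy).
have q1 : line_res b (qdisc k) = 0.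
  by apply: (qdisc_dvdP two_neq0 three_neq0 _).2 => //; exists 1; rewrite mulr1.
rewrite line_resM q1 mul0r mulr_natl -scaler_nat line_resZ line_resM => /esym/eqP.
rewrite scaler_eq0 (negPf (n0 _ _)) ?subn_gt0 ?jn ?leq_subr //= mulf_eq0.
by rewrite (negPf (line_res_deriv_qdisc two_neq0 three_neq0 bw)) orbF => /eqP.
Qed.

End Coprimality.

(** * The Euler operator and the sum of the transpositions *)

Section TranspositionSum.
Variables (V : zmodType) (act : 'S_3 -> V -> V).
Hypothesis actD : forall g u v, act g (u + v) = act g u + act g v.
Hypothesis act1 : forall u, act 1%g u = u.
Hypothesis actM : forall g h u, act (g * h)%g u = act h (act g u).

Definition transposition_sum u :=
  act (tperm 0 1) u + act (tperm 0 2) u + act (tperm 1 2) u.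

(** Composed with any transposition, the sum of the transpositions becomes the
    sum of the even permutations. *)
Lemma transposition_sum_tperm u i j : i != j ->
  act (tperm i j) (transposition_sum u) *+ 3 = transposition_sum (transposition_sum u).
Proof.
pose a : 'S_3 := tperm 0 1; pose b : 'S_3 := tperm 0 2; pose d : 'S_3 := tperm 1 2.
have SE v : transposition_sum v = act a v + act b v + act d v by [].
have Eba : (b * a = a * d)%g.
  by apply/permP; apply: ord3P; rewrite !permM !permE.
have Edb : (d * b = a * d)%g.
  by apply/permP; apply: ord3P; rewrite !permM !permE.
have Eab : (a * b = d * a)%g.
  by apply/permP; apply: ord3P; rewrite !permM !permE.
have Ebd : (b * d = d * a)%g.
  by apply/permP; apply: ord3P; rewrite !permM !permE.
have aK v : act a (act a v) = v by rewrite -actM tperm2 act1.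
have bK v : act b (act b v) = v by rewrite -actM tperm2 act1.
have dK v : act d (act d v) = v by rewrite -actM tperm2 act1.
move=> ij; have tE : [\/ tperm i j = a, tperm i j = b | tperm i j = d].
  move: i j ij; rewrite /a /b /d; do 2![apply: ord3P] => // _;
    by [constructor 1; rewrite // tpermC | constructor 2; rewrite // tpermC |
        constructor 3; rewrite // tpermC].
pose r := act (a * d)%g u; pose r' := act (d * a)%g u.
have aS : act a (transposition_sum u) = u + r + r'.
  by rewrite SE !actD aK -!actM Eba.
have bS : act b (transposition_sum u) = u + r + r'.
  by rewrite SE !actD bK -!actM Eab Edb -/r -/r' [r' + u]addrC addrAC.
have dS : act d (transposition_sum u) = u + r + r'.
  by rewrite SE !actD dK -!actM Ebd -/r -/r' addrC addrA.
rewrite [RHS]SE aS bS dS; suff -> : act (tperm i j) (transposition_sum u) = u + r + r'.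
  by rewrite mulrS mulr2n addrA.
by case: tE => ->.
Qed.

End TranspositionSum.

Section EulerOperator.
Variable k : fieldType.
Local Notation Sh := {mpoly k[2]}.
Local Notation X := ('X_ord0 : Sh).
Local Notation Y := ('X_ord_max : Sh).
Implicit Types (f u : Sh).

Lemma euler_homog d f : f \is d.-homog ->
  X * f^`M(ord0) + Y * f^`M(ord_max) = d%:R *: f.
Proof.
move=> /dhomogP fd; pose E u := X * u^`M(ord0) + Y * u^`M(ord_max).
have El : linear E.
  by move=> b u v; rewrite /E !mderivD !mderivZ -!mul_mpolyC; ring.
have E0 : E 0 = 0 by have := El (-1) 0 0; rewrite !scaleN1r oppr0 addr0 addNr.
have ED u v : E (u + v) = E u + E v by have := El 1 u v; rewrite !scale1r.
have EZ b u : E (b *: u) = b *: E u by have := El b u 0; rewrite E0 !addr0.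
have EX m (i : 'I_2) : 'X_i * ('X_[m] : Sh)^`M(i) = (m i)%:R *: 'X_[m].
  rewrite mderivX -scalerAr; case: (posnP (m i)) => [->|mi]; first by rewrite !scale0r.
  by rewrite -mpolyXD addmC submK // lep1mP -lt0n.
rewrite -/(E f) [in LHS](mpolyE f) (big_morph E ED E0) [in RHS](mpolyE f) scaler_sumr.
rewrite big_seq [RHS]big_seq; apply: eq_bigr => m /fd mE; rewrite EZ /E !EX.
rewrite -scalerDl -natrD !scalerA [d%:R * _]mulrC -!scalerA; congr (_ *: (_%:R *: _)).
by rewrite -mE /= mdegE !big_ord_recl big_ord0 addn0; congr (_ + m _)%N; apply: val_inj.
Qed.

(** The sum of the three reflections, which acts by 3, - 3 and 0 on the trivial, sign
    and reflection components. *)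
Definition refl_sum f : Sh := transposition_sum (@Sh_act k) f.

Lemma refl_sum_add : {morph refl_sum : f u / f + u}.
Proof.
move=> f u; rewrite /refl_sum /transposition_sum !Sh_act_add.
by rewrite [LHS](AC ((2*2)*2) ((1*3*5)*(2*4*6))).
Qed.

Lemma refl_sumZ b f : refl_sum (b *: f) = b *: refl_sum f.
Proof. by rewrite /refl_sum /transposition_sum !Sh_actZ !scalerDr. Qed.

Lemma refl_sum_tperm f i j : i != j ->
  3%:R *: Sh_act (tperm i j) (refl_sum f) = refl_sum (refl_sum f).
Proof.
move=> ij; rewrite scaler_nat; apply: (@transposition_sum_tperm _ (@Sh_act k)) => //.
- exact: Sh_act_add.
- exact: Sh_act1.
- exact: Sh_act_comp.
Qed.

Lemma refl_sum_cube f : refl_sum (refl_sum (refl_sum f)) = 9%:R *: refl_sum f.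
Proof.
have tt i j : i != j -> Sh_act (tperm i j) (refl_sum (refl_sum f)) = 3%:R *: refl_sum f.
  by move=> ij; rewrite -(refl_sum_tperm f ij) Sh_actZ -Sh_act_comp tperm2 Sh_act1.
by rewrite [LHS]/refl_sum /transposition_sum !tt // !scaler_nat -!mulrnDr.
Qed.

(** Eighteen times the projection of f to the sign component. *)
Definition antisym f : Sh := refl_sum (refl_sum f) - 3%:R *: refl_sum f.

Lemma semi_invariant_antisym f : semi_invariant true (antisym f).
Proof.
move=> i j ij; rewrite /antisym Sh_actB Sh_actZ (refl_sum_tperm f ij) scaleN1r opprB.
by rewrite -(refl_sum_tperm f ij) Sh_actZ -Sh_act_comp tperm2 Sh_act1.
Qed.

(** For i = 0, 1 these form the basis of h dual to the basis X, Y of h^*. *)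
Definition coroot (i : 'I_3) : 'rV[k]_3 := basis3 k i - basis3 k 2.

Lemma coroot_in_h i : in_h (coroot i).
Proof. exact: in_h_root. Qed.

Lemma corootE : [/\ coroot 0 0 0 = 1, coroot 0 0 1 = 0, coroot 0 0 2 = -1 &
  [/\ coroot 1 0 0 = 0, coroot 1 0 1 = 1 & coroot 1 0 2 = -1]].
Proof. by split; [..|split]; rewrite !mxE /= ?subr0 ?sub0r. Qed.

Lemma Sh_deriv_coroot0 f : Sh_deriv (coroot 0) f = f^`M(ord0).
Proof.
have [e0 e1 e2 _] := corootE; rewrite /Sh_deriv !big_ord_recl big_ord0 addr0.
have -> : widen23 ord0 = 0 by apply: val_inj.
have -> : widen23 (lift ord0 ord0) = 1 by apply: val_inj.
by rewrite e0 e1 scale1r scale0r addr0.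
Qed.

Lemma Sh_deriv_coroot1 f : Sh_deriv (coroot 1) f = f^`M(ord_max).
Proof.
have [_ _ _ [e0 e1 _]] := corootE; rewrite /Sh_deriv !big_ord_recl big_ord0 addr0.
have -> : widen23 ord0 = 0 by apply: val_inj.
have -> : widen23 (lift ord0 ord0) = 1 by apply: val_inj.
by rewrite e0 e1 scale1r scale0r add0r; congr (f^`M(_)); apply: val_inj.
Qed.

(** The coefficient of the divided difference along x_i - x_j adds up to
    x_i - x_j itself, which clears the denominator. *)
Lemma dunkl_euler c d f : f \is d.-homog ->
  X * dunkl 1 c (coroot 0) f + Y * dunkl 1 c (coroot 1) f =
  d%:R *: f - c *: (3%:R *: f - refl_sum f).
Proof.
move=> fd; rewrite -(euler_homog fd) -Sh_deriv_coroot0 -Sh_deriv_coroot1.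
rewrite !dunkl3E !scale1r; have [-> -> -> [-> -> ->]] := corootE.
have := divdiffP 0 1 f; have := divdiffP 0 2 f; have := divdiffP 1 2 f.
rewrite xbar0E xbar1E xbar2E /refl_sum /transposition_sum.
move: (Sh_deriv (coroot 0) f) (Sh_deriv (coroot 1) f) (divdiff 0 1 f).
move: (divdiff 0 2 f) (divdiff 1 2 f) => d02 d12 D0 D1 d01 E12 E02 E01.
rewrite -!mul_mpolyC mpolyC_nat !rmorphM !rmorphB rmorph0 rmorph1 rmorphN1 /=; move: c%:MP => c'.
rewrite [LHS](_ : _ = X * D0 + Y * D1 - c' * (d01 * (X - Y) +
  d02 * (X - - (X + Y)) + d12 * (Y - - (X + Y)))); last by ring.
rewrite E01 E02 E12; move: f (Sh_act _ f) (Sh_act _ f) (Sh_act _ f) X Y {E01 E02 E12 fd}.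
by move=> f s01 s02 s12 x y; ring.
Qed.

End EulerOperator.

(** * Submodules generated by two semi-invariants *)

Section Submodules.
Variable k : fieldType.
Local Notation Sh := {mpoly k[2]}.
Local Notation X := ('X_ord0 : Sh).
Local Notation Y := ('X_ord_max : Sh).
Implicit Types (f u : Sh).

Definition ideal2 (v w : Sh) : Sh -> Prop := fun f => exists a b, f = a * v + b * w.

Lemma in_ideal0 (f : Sh) : in_ideal [::] f <-> f = 0.
Proof.
by split=> [[a ->]|->]; [rewrite big_ord0 | exists (fun _ => 0); rewrite big_ord0].
Qed.

Lemma in_ideal1 v (f : Sh) : in_ideal [:: v] f <-> exists a, f = a * v.
Proof.
split=> [[a ->]|[a ->]]; first by exists (a ord0); rewrite big_ord1.
by exists (fun _ => a); rewrite big_ord1.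
Qed.

Lemma in_ideal2 v w (f : Sh) : in_ideal [:: v; w] f <-> ideal2 v w f.
Proof.
split=> [[a ->]|[a [b ->]]].
  by exists (a ord0), (a (lift ord0 ord0)); rewrite !big_ord_recl big_ord0 addr0.
exists (fun i => if i == ord0 then a else b).
by rewrite !big_ord_recl big_ord0 addr0.
Qed.

Section Closure.
Variables (t c : k) (N : verma t c -> Prop).
Hypothesis subN : submodule N.

Lemma submod0 : N (0 : Sh). Proof. exact: sub_0 subN. Qed.

Lemma submodD (f u : Sh) : N f -> N u -> N (f + u).
Proof. by move=> Nf Nu; have := sub_lin subN 1 Nf Nu; rewrite scale1r. Qed.

Lemma submodZ b (f : Sh) : N f -> N (b *: f).
Proof. by move=> Nf; have := sub_lin subN b Nf submod0; rewrite addr0. Qed.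

Lemma submodN (f : Sh) : N f -> N (- f).
Proof. by rewrite -scaleN1r; apply: submodZ. Qed.

Lemma submodB (f u : Sh) : N f -> N u -> N (f - u).
Proof. by move=> Nf Nu; apply: submodD => //; apply: submodN. Qed.

Lemma submodM (f u : Sh) : N u -> N (f * u).
Proof.
move=> Nu; elim/Sh_ind: f => [|b f f' Nf Nf'|i f Nf]; first by rewrite mul1r.
  by rewrite mulrDl -scalerAl; exact: sub_lin subN b _ _ Nf Nf'.
by rewrite -mulrA -Sh_lin_basis; exact: (sub_x subN (basis3 k i) Nf).
Qed.

Lemma submod_act g (f : Sh) : N f -> N (Sh_act g f).
Proof. exact: (sub_g subN). Qed.

Lemma submod_dunkl y (f : Sh) : in_h y -> N f -> N (dunkl t c y f).
Proof. exact: (sub_y subN). Qed.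

Lemma submodZ_neq0 b (f : Sh) : b != 0 -> N (b *: f) -> N f.
Proof. by move=> b0 /(submodZ b^-1); rewrite scalerA mulVf // scale1r. Qed.

End Closure.

(** By the commutation relations, an S_3-stable ideal is stable under the
    Dunkl operators as soon as these send generators into it. *)
Lemma ideal2_submodule (t c : k) (s s' : bool) v w :
  semi_invariant s v -> semi_invariant s' w ->
  (forall y, in_h y -> ideal2 v w (dunkl t c y v)) ->
  (forall y, in_h y -> ideal2 v w (dunkl t c y w)) ->
  submodule (M := verma t c) (ideal2 v w).
Proof.
move=> vP wP Dv Dw; set I := ideal2 v w.
have IM f u : I u -> I (f * u).
  by case=> a [b ->]; exists (f * a), (f * b); rewrite mulrDr !mulrA.
have IA f u : I f -> I u -> I (f + u).
  by move=> [a [b ->]] [a' [b' ->]]; exists (a + a'), (b + b'); ring.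
have IZ b f : I f -> I (b *: f) by rewrite -mul_mpolyC; apply: (IM).
have IB f u : I f -> I u -> I (f - u).
  by move=> [a [b ->]] [a' [b' ->]]; exists (a - a'), (b - b'); ring.
have I0 : I 0 by exists 0, 0; rewrite !mul0r addr0.
have Il b f u : I f -> I u -> I (b *: f + u) by move=> /(IZ b); apply: (IA).
have Ig g u : I u -> I (Sh_act g u).
  case=> a [b ->]; rewrite -[_ * v]scale1r Sh_act_linear scale1r !Sh_actM.
  rewrite (semi_invariantP g vP) (semi_invariantP g wP).
  by apply: (IA); rewrite -scalerAr; apply: (IZ); apply: (IM);
     [exists 1, 0 | exists 0, 1]; rewrite mul0r mul1r ?addr0 ?add0r.
have DM y u : in_h y -> I u -> I (dunkl t c y u) -> forall f, I (dunkl t c y (f * u)).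
  move=> hy Iu IDu; apply: Sh_ind => [|b f f' IHf IHf'|i f IHf].
  - by rewrite mul1r.
  - have -> : (b *: f + f') * u = b *: (f * u) + f' * u by rewrite mulrDl scalerAl.
    by have -> := dunkl_linear t c y b (f * u) (f' * u); apply: Il.
  rewrite -mulrA -Sh_lin_basis dunkl_linM //; apply: (IA); first exact: IM.
  have Ifu := IM f _ Iu; apply: (IB); first exact: IZ.
  have IcZ g b' := IZ b' _ (Ig g _ Ifu).
  by rewrite sum_reflections; exact: (IA _ _ (IA _ _ (IcZ _ _) (IcZ _ _)) (IcZ _ _)).
split => //; first by move=> x u; apply: (IM).
move=> y u hy [a [b ->]] /=; rewrite -[a * v]scale1r dunkl_linear scale1r.
apply: (IA); apply: DM => //; [|exact: Dv| |exact: Dw].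
  by exists 1, 0; rewrite mul1r mul0r addr0.
by exists 0, 1; rewrite mul1r mul0r add0r.
Qed.

Lemma generated_ideal2 (t c : k) v w f :
  submodule (M := verma t c) (ideal2 v w) ->
  generated_submodule (M := verma t c) [:: v; w] f <-> ideal2 v w f.
Proof.
move=> subI; split=> [Jf|[a [b ->]] N subN Nr].
  apply: Jf => // u; rewrite !inE => /orP[] /eqP ->.
    by exists 1, 0; rewrite mul1r mul0r addr0.
  by exists 0, 1; rewrite mul1r mul0r add0r.
by apply: submodD => //; apply: submodM => //; apply: Nr; rewrite !inE eqxx ?orbT.
Qed.

(** * Vectors that are singular modulo a submodule *)

Section Singular.
Variables (c : k) (N : verma 1 c -> Prop).
Hypothesis subN : submodule N.
Variables (d : nat) (f : Sh).
Hypothesis f_homog : f \is d.-homog.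
Hypothesis f_sing : forall y, in_h y -> N (dunkl 1 c y f).

(** The Euler operator sends f into N, which ties the degree of f to the action
    of the reflections on it. *)
Lemma singular_refl_sum : N (c *: refl_sum f - (3%:R * c - d%:R) *: f).
Proof.
have := dunkl_euler c f_homog.
have -> : d%:R *: f - c *: (3%:R *: f - refl_sum f) =
   c *: refl_sum f - (3%:R * c - d%:R) *: f.
  rewrite scalerBl scalerBr !scalerA [c * _]mulrC.
  by move: (_ *: f) (_ *: f) (_ *: refl_sum f) => *; ring.
by move=> <-; apply: submodD => //; apply: submodM => //;
  apply: f_sing; apply: coroot_in_h.
Qed.

Lemma N_refl_sum (u : Sh) : N u -> N (refl_sum u).
Proof.
by move=> Nu; rewrite /refl_sum /transposition_sum;
  do 2?[apply: submodD => //]; apply: submod_act.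
Qed.

(** Modulo N, the operator c * refl_sum multiplies f by 3 c - d, while
    its eigenvalues are 0, 3 c and - 3 c. *)
Lemma singular_degree :
  N ((d%:R * (3%:R * c - d%:R) * (6%:R * c - d%:R)) *: f).
Proof.
pose m := 3%:R * c - d%:R; pose T u : Sh := c *: refl_sum u.
have TN u : N u -> N (T u) by move=> Nu; apply: submodZ => //; apply: N_refl_sum.
have T1 : N (T f - m *: f) := singular_refl_sum.
have TZ b u : T (b *: u) = b *: T u by rewrite /T refl_sumZ !scalerA mulrC.
have TB u v : T (u - v) = T u - T v.
  rewrite -scaleN1r /T refl_sum_add refl_sumZ.
  by move: (refl_sum u) (refl_sum v) => su sv; rewrite scaleN1r scalerBr.
have T3 : T (T (T f)) = (9%:R * c ^+ 2) *: T f.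
  by rewrite /T !refl_sumZ refl_sum_cube !scalerA; congr (_ *: _); ring.
have mE : m = 3%:R * c - d%:R by [].
clearbody T m; have T2 : N (T (T f) - (m ^+ 2) *: f).
  have := submodD subN (TN _ T1) (submodZ subN m T1).
  by rewrite TB TZ scalerBr scalerA -expr2 addrA subrK.
have T4 : N (T (T (T f)) - (m ^+ 2) *: T f) by have := TN _ T2; rewrite TB TZ.
rewrite T3 -scalerBl in T4.
have := submodB subN T4 (submodZ subN (9%:R * c ^+ 2 - m ^+ 2) T1).
rewrite scalerBr opprB addrCA subrr addr0 scalerA.
by congr N; congr (_ *: _); rewrite mE; ring.
Qed.

(** The eigenvalue of refl_sum on f modulo N is - 3 here, that of the sign
    character. *)
Lemma singular_antisym : d%:R = 6%:R * c -> c != 0 ->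
  N (antisym f - 18%:R *: f).
Proof.
move=> dc c0; have S1 : N (refl_sum f + 3%:R *: f).
  apply: (submodZ_neq0 subN c0); have := singular_refl_sum; congr N.
  rewrite dc; move: (refl_sum f) => s; rewrite scalerDr scalerA -scaleNr.
  by congr (_ + _ *: _); ring.
have S2 := N_refl_sum S1; rewrite refl_sum_add refl_sumZ in S2.
have := submodB subN S2 (submodZ subN 6%:R S1); congr N.
rewrite /antisym; move: (refl_sum (refl_sum f)) (refl_sum f) (f) => s2 s1 s0.
by rewrite -!mul_mpolyC !mpolyC_nat; ring.
Qed.

(** One step down the sl_2-string of f: the raising operator is multiplication by
    sigma2 and the lowering one is quadratic in the Dunkl operators.  The
    first Dunkl operator puts every x sigma2 ^ j f in N, the second one brings in the
    weight 2 (j + 1 - 3 c + d). *)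
Lemma singular_lower j : j.+1%:R != 0 :> k -> 3%:R != 0 :> k ->
  2%:R * (j.+1%:R - 3%:R * c + d%:R) != 0 :> k ->
  N (sigma2 k ^+ j.+1 * f) -> N (sigma2 k ^+ j * f).
Proof.
move=> j0 t0 jd0 Nf; have s2i n := semi_invariantX n (semi_invariant_sigma2 k).
have Dinv n y u : dunkl 1 c y (sigma2 k ^+ n * u) =
    sigma2 k ^+ n * dunkl 1 c y u + Sh_deriv y (sigma2 k ^+ n) * u.
  by apply: dunkl_invM; have := s2i n; rewrite andbF.
have N1 y : in_h y -> N (j.+1%:R * (sigma2 k ^+ j * Sh_deriv y (sigma2 k)) * f).
  move=> hy; have := submod_dunkl subN hy Nf; rewrite Dinv Sh_derivX.
  move=> /submodB - /(_ subN _ (submodM subN (sigma2 k ^+ j.+1) (f_sing hy))).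
  by rewrite addrC addKr.
have [e0 e1 _ [e0' e1' _]] := corootE k.
have N2 := N1 _ (coroot_in_h k 0); have N3 := N1 _ (coroot_in_h k 1).
rewrite Sh_deriv_sigma2 ?e0 ?e1 in N2; last exact: coroot_in_h.
rewrite Sh_deriv_sigma2 ?e0' ?e1' in N3; last exact: coroot_in_h.
(* The derivatives of sigma2 span h^*, as 3 is invertible. *)
have jt0 : 3%:R * j.+1%:R != 0 :> k by rewrite mulf_neq0.
have NX : N (sigma2 k ^+ j * (X * f)).
  apply: (submodZ_neq0 subN jt0).
  have := submodD subN (submodM subN (- 2%:R) N2) N3; congr N.
  rewrite mpolyC0 mpolyC1 -mul_mpolyC rmorphM /= !mpolyC_nat.
  by move: (_ ^+ j) j.+1%:R X Y (f) => *; ring.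
have NY : N (sigma2 k ^+ j * (Y * f)).
  apply: (submodZ_neq0 subN jt0).
  have := submodD subN (submodM subN (- 2%:R) N3) N2; congr N.
  rewrite mpolyC0 mpolyC1 -mul_mpolyC rmorphM /= !mpolyC_nat.
  by move: (_ ^+ j) j.+1%:R X Y (f) => *; ring.
(* The trace over h of the commutators [y, x]: each 1 - s has trace 2 on h^*. *)
have commE : dunkl_comm 1 c (coroot k 0) (basis3 k 0) f +
             dunkl_comm 1 c (coroot k 1) (basis3 k 1) f =
    2%:R *: f - (2%:R * c) *: refl_sum f.
  rewrite /dunkl_comm !sum_reflections !pairing_reflection !pairing_basis.
  have [-> -> -> [-> -> ->]] := corootE k.
  rewrite !mxE /= /refl_sum /transposition_sum -!mul_mpolyC.
  move: (Sh_act _ f) (Sh_act _ f) (Sh_act _ f) => s1 s2 s3; move: (f) => f'.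
  by rewrite !(rmorphM, rmorphB, rmorphN1, rmorph0, rmorph1, rmorph_nat) /=;
     move: c%:MP => c'; ring.
apply: (submodZ_neq0 subN jd0).
have N4 := submod_dunkl subN (coroot_in_h k 0) NX.
have N5 := submod_dunkl subN (coroot_in_h k 1) NY.
have N6 := submodD subN N4 N5.
have N7 := submodM subN (sigma2 k ^+ j) (submodD subN
  (submodM subN X (f_sing (coroot_in_h k 0))) (submodM subN Y (f_sing (coroot_in_h k 1)))).
have N8 := submodM subN (2%:R * sigma2 k ^+ j) singular_refl_sum.
have := submodD subN (submodB subN N6 N7) N8; congr N.
have DX i y : in_h y -> dunkl 1 c y (xbar k i * f) =
    xbar k i * dunkl 1 c y f + dunkl_comm 1 c y (basis3 k i) f.
  by move=> hy; rewrite -Sh_lin_basis dunkl_linM.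
have D0X := DX 0 _ (coroot_in_h k 0); have D1Y := DX 1 _ (coroot_in_h k 1).
rewrite xbar0E in D0X; rewrite xbar1E in D1Y.
rewrite !Dinv D0X D1Y Sh_deriv_coroot0 Sh_deriv_coroot1.
have := euler_homog (dhomogMn j (sigma2_homog k)).
move: (dunkl_comm _ _ _ _ _) (dunkl_comm _ _ _ _ _) commE => C1 C0 commE.
move: (_^`M(_)) (_^`M(_)) => dY dX eul.
move: (dunkl _ _ _ _) (dunkl _ _ _ _) => DY1 DX0.
rewrite [LHS](_ : _ = sigma2 k ^+ j * (C0 + C1) + (X * dX + Y * dY) * f +
  2%:R * sigma2 k ^+ j * (c *: refl_sum f - (3%:R * c - d%:R) *: f)); last by ring.
rewrite commE eul -!mul_mpolyC !(rmorphM, rmorphB, rmorphD, rmorph_nat) /= mpolyC1.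
rewrite -[j.+1%:R]nat1r; move: (sigma2 k ^+ j) (refl_sum f) => s r.
by move: (f) c%:MP j%:R d%:R => *; ring.
Qed.

(** Once the sl_2-string of a singular vector f dies in the quotient without
    crossing a lowest weight, f itself vanishes there. *)
Lemma singular_descend l : 3%:R != 0 :> k ->
  (forall j, (j < l)%N ->
     j.+1%:R != 0 :> k /\ 2%:R * (j.+1%:R - 3%:R * c + d%:R) != 0 :> k) ->
  N (sigma2 k ^+ l * f) -> N f.
Proof.
move=> t0 hl; elim: l hl => [|l IHl] hl; first by rewrite mul1r.
have [j0 jd0] := hl l (leqnn _); move/(singular_lower j0 t0 jd0).
by apply: IHl => j jl; apply: hl; apply: leqW.
Qed.

End Singular.
End Submodules.

(** * Graded pieces in the Grothendieck group *)

Section AdditiveExact.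
Variables (F : fieldType) (gT : finGroupType) (G : {group gT}).
Local Notation grepr := (representation F G).

(** Additivity on abstract short exact sequences, given by matrices, rather
    than on a submodule of a fixed representation. *)
Lemma additive_exact (A : zmodType) (phi : grepr -> A) (r' r r'' : grepr)
    (M : 'M[F]_(rdegree r', rdegree r)) (M' : 'M[F]_(rdegree r, rdegree r'')) :
  additive_invariant phi -> row_free M -> row_full M' -> (kermx M' :=: M)%MS ->
  (forall g, g \in G -> r' g *m M = M *m r g) ->
  (forall g, g \in G -> r g *m M' = M' *m r'' g) ->
  phi r = phi r' + phi r''.
Proof.
case: r' r r'' M M' => [n' rG'] [n rG] [n'' rG''] /= M M'.
move=> [phi_sim phi_ex] Mfree M'full kerM hM hM'; pose U := kermx M'.
have rankU : \rank U = n' by rewrite kerM; apply/eqP.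
have n_def : (\rank U + n'' = n)%N.
  by rewrite mxrank_ker (eqP M'full) subnK // -(eqP M'full) rank_leq_row.
have Umod : mxmodule rG U.
  apply/mxmoduleP => g Gg; apply/sub_kermxP; rewrite -mulmxA hM' // mulmxA.
  by rewrite mulmx_ker mul0mx.
rewrite (phi_ex n rG U Umod); congr (_ + _); apply: phi_sim.
  have MU : (M <= U)%MS by rewrite /U kerM.
  apply: mx_rsim_sym; exists (in_submod U M) => //=.
    by rewrite /row_free mxrank_in_submod.
  move=> g Gg; rewrite -[RHS](in_submodJ Umod g MU) -(hM g Gg).
  by rewrite in_submodE [RHS]in_submodE mulmxA.
exists (val_factmod 1%:M *m M') => /=.
- by rewrite mxrank_coker rankU; rewrite -n_def rankU addKn.
- apply: inj_row_free => v; rewrite mulmxA -val_factmodE => vM; apply/eqP.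
  have := in_factmod_eq0 U (val_factmod v); rewrite val_factmodK => ->.
  exact/sub_kermxP.
move=> g Gg; rewrite [LHS]mulmxA -val_factmodE -[RHS]mulmxA -(hM' g Gg) [RHS]mulmxA.
apply/eqP; rewrite -subr_eq0 -mulmxBl -sub_kermx -/U -in_factmod_eq0 linearB /=.
by rewrite in_factmodJ // !val_factmodK mul1mx subrr.
Qed.

End AdditiveExact.

Section Twist.
Variables (k : fieldType).
Local Notation grepr := (representation k [set: 'S_3]).

Lemma mulmx_inj (F : fieldType) m n (A B : 'M[F]_(m, n)) :
  (forall w : 'rV_m, w *m A = w *m B) -> A = B.
Proof. by move=> AB; apply/row_matrixP => i; rewrite !rowE AB. Qed.

Lemma trow_tprod (F : fieldType) n1 p1 m2 n2 p2 (w : 'rV[F]_n1)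
    (B : 'M[F]_(m2, n2)) (A : 'M[F]_(n1, p1)) (B' : 'M[F]_(n2, p2)) :
  trow w B *m tprod A B' = trow (w *m A) (B *m B').
Proof.
have usub1 n (u : 'M[F]_(1 + 0, n)) : usubmx u = u.
  by apply/matrixP => i j; rewrite mxE; congr (u _ j); apply: val_inj.
have := @tprodE F 1 _ _ w A _ _ _ B B' => /= /esym; rewrite mul_col_mx.
by case/eq_col_mx => + _; rewrite !usub1.
Qed.

Lemma trow1_inj (F : fieldType) n (w : 'rV[F]_n) :
  trow w (1%:M : 'M[F]_1) = 0 -> w = 0.
Proof.
elim: n w => [|n IHn] w /=; first by rewrite [w]thinmx0.
have -> : 0 = row_mx 0 0 :> 'M[F]_(1, 1 + n * 1) by rewrite row_mx0.
case/eq_row_mx => w0 /IHn w1; rewrite -[w](@hsubmxK F 1 1 n) w1.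
have -> : lsubmx (w : 'rV_(1 + n)) = 0.
  apply/matrixP => i j; rewrite !ord1; move/matrixP/(_ 0 0): w0.
  by rewrite !mxE eqxx mulr1.
by rewrite row_mx0.
Qed.

(** The tensor product with a one-dimensional character, in the dimension of r
    itself rather than in dimension rdegree r * 1. *)
Definition twist_mx (r : grepr) (b : bool) (g : 'S_3) : 'M[k]_(rdegree r) :=
  (-1) ^+ (b && odd_perm g) *: r g.

Lemma twist_mx_repr r b : mx_repr [set: 'S_3] (twist_mx r b).
Proof.
split=> [|g g' _ _]; first by rewrite /twist_mx repr_mx1 odd_perm1 andbF scale1r.
rewrite /twist_mx repr_mxM ?inE // odd_permM -scalemxAl -scalemxAr scalerA.
by case: b; rewrite ?signr_addb //= mulr1.
Qed.

Definition twist r b : grepr := Representation (MxRepresentation (twist_mx_repr r b)).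

Lemma twist_false r : mx_rsim (twist r false) r.
Proof.
exists 1%:M => //; first by rewrite /row_free mxrank1.
by move=> g _; rewrite mulmx1 mul1mx /= /twist_mx scale1r.
Qed.

Lemma twist_prod (r : grepr) b (X : mx_representation k [set: 'S_3] 1) :
  (forall g, X g = ((-1) ^+ (b && odd_perm g))%:M) ->
  mx_rsim (twist r b) (prod_repr r X).
Proof.
move=> XE; pose T := lin1_mx (trowb (n1 := rdegree r) (1%:M : 'M[k]_1)).
have TE w : w *m T = trow w (1%:M : 'M[k]_1) by rewrite mul_rV_lin1.
exists T; first by rewrite muln1.
  by apply: inj_row_free => w; rewrite TE; apply: trow1_inj.
move=> g _; apply: mulmx_inj => w; rewrite !mulmxA !TE trow_tprod mul1mx XE.
rewrite /twist /= /twist_mx -scalemxAr -trowbE linearZ /= trowbE.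
by rewrite -[(_ ^+ _)%:M]scalemx1 linearZ.
Qed.

End Twist.

Section Pieces.
Variable k : fieldType.
Local Notation Sh := {mpoly k[2]}.
Local Notation grepr := (representation k [set: 'S_3]).
Implicit Types (f u v : Sh) (N : Sh -> Prop).

Lemma pihomogM d e f v : v \is e.-homog ->
  pihomog mdeg d (f * v) = (if (e <= d)%N then pihomog mdeg (d - e) f else 0) * v.
Proof.
move=> ve; elim/mpolyind: f => [|b m f _ _ IHf].
  by rewrite mul0r !pihomog0; case: ifP; rewrite mul0r.
have XP : ('X_[m] : Sh) \is (mdeg m).-homog by rewrite dhomogX.
have XvP := dhomogM XP ve.
have IHm : pihomog mdeg d ('X_[m] * v) =
    (if (e <= d)%N then pihomog mdeg (d - e) 'X_[m] else 0) * v.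
  have [E|E] := eqVneq (mdeg m + e)%N d.
    by rewrite -E leq_addl addnK !pihomog_dE.
  rewrite (pihomog_ne0 E) //; case: ifP => [ed|]; last by rewrite mul0r.
  by rewrite (pihomog_ne0 _ XP) ?mul0r //; apply: contra_neq E => ->; rewrite subnK.
rewrite mulrDl -scalerAl !linearD !linearZ /= IHf IHm; case: ifP => _.
  by rewrite mulrDl scalerAl.
by rewrite mul0r scaler0 addr0.
Qed.

Definition graded_subrep N := [/\ N 0, forall b f u, N f -> N u -> N (b *: f + u),
  forall g f, N f -> N (Sh_act g f) & forall d f, N f -> N (pihomog mdeg d f)].

Lemma graded_pieceP N d : graded_subrep N -> affords_piece N d (piece N d).
Proof. by case=> N0 Nl Ng _; apply: pieceP. Qed.

(** Linear maps on homogeneous polynomials descend to the graded pieces, which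
    are known only through a surjection pi1 from Sh. *)
Lemma induced_mx n1 n2 d (pi1 : {linear Sh -> 'rV[k]_n1}) (K : Sh -> 'rV[k]_n2) :
  linear K -> (forall w, exists2 f, f \is d.-homog & pi1 f = w) ->
  (forall f, f \is d.-homog -> pi1 f = 0 -> K f = 0) ->
  exists M : 'M_(n1, n2), forall f, f \is d.-homog -> pi1 f *m M = K f.
Proof.
move=> Kl pi1_onto K0.
have KD f u : K (f + u) = K f + K u by rewrite -[f]scale1r Kl !scale1r.
have K00 : K 0 = 0 by have := Kl (-1) 0 0; rewrite !scaleN1r oppr0 addr0 addNr.
have KZ b f : K (b *: f) = b *: K f by rewrite -[b *: f]addr0 Kl K00 addr0.
have [h hP] : exists h : 'I_n1 -> Sh, forall i,
    h i \is d.-homog /\ pi1 (h i) = delta_mx 0 i.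
  apply: (@fin_all_exists _ (fun _ => Sh)
    (fun i f => f \is d.-homog /\ pi1 f = delta_mx 0 i)) => i.
  by have [f fd fi] := pi1_onto (delta_mx 0 i); exists f.
exists (\matrix_i K (h i)) => f fd; rewrite mulmx_sum_row.
pose f' := \sum_i pi1 f 0 i *: h i.
have f'd : f' \is d.-homog by apply: rpred_sum => i _; apply: rpredZ; case: (hP i).
have pf' : pi1 f' = pi1 f.
  rewrite linear_sum [RHS]row_sum_delta; apply: eq_bigr => i _.
  by rewrite linearZ /=; have [_ ->] := hP i.
have -> : K f = K f'.
  rewrite -[f](subrK f') KD K0 ?add0r ?rpredB //.
  by rewrite linearB /= pf' subrr.
by rewrite /f' (big_morph K KD K00); apply: eq_bigr => i _; rewrite rowK KZ.
Qed.

(** If multiplication by a semi-invariant v is injective on the quotient by N,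
    then the quotients by N, twisted and shifted, by N and by N + (v) form a short
    exact sequence in each degree. *)
Section Koszul.
Variables (N N' : Sh -> Prop) (v : Sh) (e : nat) (b : bool).
Hypotheses (NP : graded_subrep N) (N'P : graded_subrep N').
Hypotheses (v_homog : v \is e.-homog) (v_semi : semi_invariant b v).
Hypothesis v_regular : forall f, N (f * v) <-> N f.
Hypothesis N'E : forall f, N' f <-> exists a u, N u /\ f = u + a * v.

Variables (A : zmodType) (phi : grepr -> A).
Hypothesis phi_additive : additive_invariant phi.

Let NN' f : N f -> N' f.
Proof. by move=> Nf; apply/N'E; exists 0, f; rewrite mul0r addr0. Qed.

Lemma phi_piece_small d : (d < e)%N -> phi (piece N d) = phi (piece N' d).
Proof.
move=> de; have [phi_sim _] := phi_additive; apply: phi_sim.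
have [pi [pi_onto pi_ker pi_act]] := graded_pieceP d NP.
have [pi' [pi'_onto pi'_ker pi'_act]] := graded_pieceP d N'P.
have pi'l : linear pi' by exact: linearP.
have N'N f : f \is d.-homog -> N' f -> N f.
  move=> fd /N'E[a [u [Nu fE]]]; have [_ _ _ Nh] := NP.
  rewrite -(pihomog_dE fd) fE linearD /= (pihomogM _ _ v_homog).
  by rewrite leqNgt de mul0r addr0; apply: Nh.
have [|M ME] := induced_mx pi'l pi_onto.
  by move=> f fd /pi_ker - /(_ fd) /NN' Nf; apply/pi'_ker.
have Mfree : row_free M.
  apply: inj_row_free => w; have [f fd <-] := pi_onto w; rewrite ME //.
  by move/pi'_ker => /(_ fd) /(N'N _ fd) Nf; apply/pi_ker.
have Mfull : row_full M.
  rewrite -sub1mx; apply/rV_subP => w _; have [f fd <-] := pi'_onto w.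
  by rewrite -ME // submxMl.
exists M => //; first by rewrite -(eqP Mfree) (eqP Mfull).
move=> g _; apply: mulmx_inj => w; have [f fd <-] := pi_onto w.
rewrite !mulmxA -pi_act // !ME //; last exact: Sh_act_homog.
by rewrite pi'_act.
Qed.

Lemma phi_piece_shift d : (e <= d)%N ->
  phi (piece N d) = phi (twist (piece N (d - e)) b) + phi (piece N' d).
Proof.
move=> ed; have [N0 Nl Ng Nh] := NP.
have [pi [pi_onto pi_ker pi_act]] := graded_pieceP d NP.
have [pi' [pi'_onto pi'_ker pi'_act]] := graded_pieceP d N'P.
have [rho [rho_onto rho_ker rho_act]] := graded_pieceP (d - e) NP.
have pi'l : linear pi' by exact: linearP.
have mulv f : f \is (d - e).-homog -> f * v \is d.-homog.
  by move=> fd; rewrite -(subnK ed); apply: dhomogM.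
have pivl : linear (fun f => pi (f * v)).
  by move=> a f u; rewrite mulrDl -scalerAl; exact: linearP.
have [|M' ME'] := induced_mx pi'l pi_onto.
  by move=> f fd /pi_ker - /(_ fd) /NN' Nf; apply/pi'_ker.
have [|M ME] := induced_mx pivl rho_onto.
  move=> f fd /rho_ker - /(_ fd) Nf; apply/pi_ker; first exact: mulv.
  exact/v_regular.
apply: (@additive_exact _ _ _ _ _ (twist (piece N (d - e)) b) _ _ M M') => //=.
- apply: inj_row_free => w; have [f fd <-] := rho_onto w; rewrite ME //.
  by move/pi_ker => /(_ (mulv _ fd)) /v_regular Nf; apply/rho_ker.
- rewrite -sub1mx; apply/rV_subP => w _; have [f fd <-] := pi'_onto w.
  by rewrite -ME' // submxMl.
- apply/eqmxP/rV_eqP => w; apply/idP/idP.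
    move/sub_kermxP; have [f fd <-] := pi_onto w; rewrite ME' //.
    move/pi'_ker => /(_ fd) /N'E[a [u [Nu fE]]].
    rewrite -(pihomog_dE fd) fE linearD /= (pihomogM _ _ v_homog) ed linearD /=.
    rewrite (pi_ker _ (pihomogP _ _ _)).2 ?add0r; last exact: Nh.
    by rewrite -ME ?submxMl //; apply: pihomogP.
  case/submxP=> w' ->; have [f fd <-] := rho_onto w'; rewrite ME //.
  apply/sub_kermxP; rewrite ME' ?mulv //; apply/pi'_ker; first exact: mulv.
  by apply/N'E; exists f, 0; rewrite add0r.
- move=> g _; apply: mulmx_inj => w; have [f fd <-] := rho_onto w.
  rewrite /twist_mx !mulmxA -scalemxAr -scalemxAl -rho_act // !ME //; last first.
    exact: Sh_act_homog.
  rewrite -pi_act ?mulv // Sh_actM (semi_invariantP g v_semi) -scalerAr linearZ //.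
- move=> g _; apply: mulmx_inj => w; have [f fd <-] := pi_onto w.
  rewrite !mulmxA -pi_act // !ME' //; last exact: Sh_act_homog.
  by rewrite pi'_act.
Qed.

End Koszul.

Lemma graded_subrep0 : graded_subrep (@zero_sub k).
Proof.
rewrite /graded_subrep /zero_sub; split=> [|b f u -> ->|g f ->|d f ->]; first by [].
- by rewrite scaler0 addr0.
- by have := Sh_actZ g 0 (0 : Sh); rewrite !scale0r.
- exact: pihomog0.
Qed.

Lemma hilb_zero_sub d : hilb (@zero_sub k) d = d.+1.
Proof.
have [pi [pi_onto pi_ker _]] := graded_pieceP d graded_subrep0.
rewrite /hilb; set n := rdegree _ in pi pi_onto pi_ker *.
pose mon (i : 'I_d.+1) : 'X_{1..2} :=
  [multinom (if j == ord0 then (i : nat) else (d - i)%N) | j < 2].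
have mon_deg i : mdeg (mon i) = d.
  by rewrite mdegE !big_ord_recl big_ord0 !mnmE /= addn0 subnKC // -ltnS.
have mon_inj : injective mon.
  by move=> i j /mnmP/(_ ord0); rewrite !mnmE /= => /val_inj.
have monP m : mdeg m = d -> exists i, m = mon i.
  rewrite mdegE !big_ord_recl big_ord0 /= addn0 => md.
  have hi : (m ord0 < d.+1)%N by rewrite ltnS -md leq_addr.
  exists (Ordinal hi); apply/mnmP => j; rewrite !mnmE /=.
  case: eqVneq => [->//|j0]; rewrite -md addKn; congr (m _); apply: val_inj.
  by case: j j0 => [[|[|//]]].
pose M := \matrix_i pi 'X_[mon i].
have ME w : w *m M = pi (\sum_i w 0 i *: 'X_[mon i]).
  by rewrite mulmx_sum_row linear_sum; apply: eq_bigr => i _; rewrite rowK linearZ.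
have sum_homog (w : 'rV[k]_d.+1) : \sum_i w 0 i *: 'X_[mon i] \is d.-homog.
  by apply: rpred_sum => i _; apply: rpredZ; rewrite dhomogX /= mon_deg.
have coef_sum (F : 'I_d.+1 -> k) j : (\sum_i F i *: 'X_[mon i])@_(mon j) = F j.
  rewrite raddf_sum (bigD1 j) //= mcoeffZ mcoeffX eqxx mulr1 big1 ?addr0 // => i ij.
  by rewrite mcoeffZ mcoeffX (inj_eq mon_inj) (negPf ij) mulr0.
have Mfree : row_free M.
  apply: inj_row_free => w; rewrite ME => /(pi_ker _ (sum_homog w)).1 w0.
  by apply/rowP => j; rewrite -(coef_sum (fun i => w 0 i)) w0 mcoeff0 mxE.
have Mfull : row_full M.
  rewrite -sub1mx; apply/rV_subP => w _; have [f fd <-] := pi_onto w.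
  have -> : f = \sum_i (\row_i f@_(mon i)) 0 i *: 'X_[mon i].
    apply/mpolyP => m; have [/monP[i ->]|md] := eqVneq (mdeg m) d.
      by rewrite coef_sum mxE.
    by rewrite (dhomog_nemf_coeff fd md) (dhomog_nemf_coeff (sum_homog _) md).
  by rewrite -ME submxMl.
by rewrite -(eqP Mfull) (eqP Mfree).
Qed.

End Pieces.

(** * The character of a complete intersection *)

Section Characters.
Variable k : fieldType.
Local Notation Sh := {mpoly k[2]}.
Local Notation grepr := (representation k [set: 'S_3]).
Implicit Types (f u v : Sh) (N : Sh -> Prop).

Section Evaluation.
Variables (A : zmodType) (phi : grepr -> A).

Definition K0_eval (s : K0_term k [set: 'S_3]) : A := \sum_(x <- s) phi x.2 *~ x.1.

Definition K0_eval_prod (r : grepr) (s : K0_term k [set: 'S_3]) : A :=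
  \sum_(x <- s) phi (Representation (prod_repr r x.2)) *~ x.1.

Lemma K0_eval_mul (f g : K0_series k [set: 'S_3]) (r : nat -> grepr) d :
  (forall i, f i = K0_class (r i)) ->
  K0_eval (K0s_mul f g d) = \sum_(i < d.+1) K0_eval_prod (r i) (g (d - i)%N).
Proof.
move=> fE; rewrite /K0s_mul.
rewrite (big_morph K0_eval (id1 := 0) (op1 := +%R)); last by rewrite /K0_eval big_nil.
  apply: eq_bigr => i _; rewrite fE /K0_eval /K0_mul /= cats0 big_map.
  by apply: eq_bigr => x _; rewrite mul1r.
by move=> s s'; rewrite /K0_eval big_cat.
Qed.

Lemma K0_eval_prodD r (s s' : K0_series k [set: 'S_3]) d :
  K0_eval_prod r (K0s_add s s' d) = K0_eval_prod r (s d) + K0_eval_prod r (s' d).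
Proof. exact: big_cat. Qed.

Lemma K0_eval_prodB r (s s' : K0_series k [set: 'S_3]) d :
  K0_eval_prod r (K0s_sub s s' d) = K0_eval_prod r (s d) - K0_eval_prod r (s' d).
Proof.
rewrite /K0_eval_prod big_cat big_map -sumrN; congr (_ + _).
by apply: eq_bigr => x _; rewrite mulrNz.
Qed.

Lemma sum_K0_eval_mono (r : nat -> grepr) R n d :
  \sum_(i < d.+1) K0_eval_prod (r i) (K0s_mono R n (d - i)%N) =
  if (n <= d)%N then phi (Representation (prod_repr (r (d - n)%N) R)) else 0.
Proof.
have E i : K0_eval_prod (r i) (K0s_mono R n (d - i)%N) =
    if (d - i == n)%N then phi (Representation (prod_repr (r i) R)) else 0.
  by rewrite /K0s_mono; case: ifP => _; rewrite /K0_eval_prod ?big_nil // big_seq1.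
under eq_bigr do rewrite E; rewrite -big_mkcond /=.
case: leqP => [nd|dn].
  rewrite (big_pred1 (inord (d - n))) => [|i /=].
    by rewrite inordK // ltnS leq_subr.
  rewrite -val_eqE /= inordK ?ltnS ?leq_subr //.
  by have := ltn_ord i; move: (val i) => j; lia.
rewrite big_pred0 // => i; have := ltn_ord i; move: (val i) => j; lia.
Qed.

End Evaluation.

Lemma graded_ideal2 s s' d d' v w : semi_invariant s v -> semi_invariant s' w ->
  v \is d.-homog -> w \is d'.-homog -> graded_subrep (ideal2 v w).
Proof.
move=> vP wP vd wd; split.
- by exists 0, 0; rewrite !mul0r addr0.
- move=> b f u [a [a' ->]] [c [c' ->]]; exists (b *: a + c), (b *: a' + c').
  by rewrite -!mul_mpolyC; ring.
- move=> g f [a [b ->]]; have := Sh_act_linear g 1 (a * v) (b * w).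
  rewrite !scale1r => ->; rewrite !Sh_actM (semi_invariantP g vP).
  rewrite (semi_invariantP g wP) -!scalerAr !scalerAl.
  by eexists; eexists.
move=> n f [a [b ->]]; rewrite linearD /= (pihomogM _ _ vd) (pihomogM _ _ wd).
by eexists; eexists.
Qed.

(** The Koszul resolution of an ideal generated by a regular sequence of two
    semi-invariants, of types Sign and Triv. *)
Section TwoGenerators.
Variables (v w : Sh) (d d' : nat).
Hypotheses (v_semi : semi_invariant true v) (w_semi : semi_invariant false w).
Hypotheses (v_homog : v \is d.-homog) (w_homog : w \is d'.-homog).
Hypothesis v_neq0 : v != 0.
Hypothesis w_regular : forall f, (exists u, f * w = v * u) -> exists u, f = v * u.
Variable J : Sh -> Prop.
Hypothesis JE : forall f, J f <-> ideal2 v w f.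

Lemma graded_J : graded_subrep J.
Proof.
have [I0 Il Ig Ih] := graded_ideal2 v_semi w_semi v_homog w_homog.
split=> [|b f u /JE If /JE Iu|g f /JE If|n f /JE If]; apply/JE => //.
- exact: Il.
- exact: Ig.
- exact: Ih.
Qed.

Let A0 n := piece (@zero_sub k) n.

Lemma phi_piece_J (A : zmodType) (phi : grepr -> A) n : additive_invariant phi ->
  phi (piece J n) =
    phi (A0 n)
    - (if (d <= n)%N then phi (twist (A0 (n - d)) true) else 0)
    - (if (d' <= n)%N then phi (A0 (n - d')) else 0)
    + (if (d + d' <= n)%N then phi (twist (A0 (n - (d + d'))) true) else 0).
Proof.
move=> phiP; have [phi_sim _] := phiP; pose V := ideal2 v 0.
have zero_semi : semi_invariant true (0 : Sh).
  by move=> i j _; rewrite -(scale0r 0) Sh_actZ !scale0r scaler0.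
have VP : graded_subrep V.
  by apply: (graded_ideal2 (d' := 0) v_semi zero_semi v_homog); apply: rpred0.
have VE f : V f <-> exists a u, zero_sub u /\ f = u + a * v.
  split=> [[a [b ->]]|[a [u [-> ->]]]].
    by exists a, 0; rewrite mulr0 addr0 add0r.
  by exists a, 0; rewrite mulr0 addr0 add0r.
have v_reg f : zero_sub (f * v) <-> zero_sub f.
  rewrite /zero_sub; split=> [/eqP|->]; last by rewrite mul0r.
  by rewrite mulf_eq0 (negPf v_neq0) orbF => /eqP.
have w_reg f : V (f * w) <-> V f.
  split=> [[a [b fw]]|[a [b ->]]]; last first.
    by exists (w * a), 0; rewrite !mulr0 !addr0; ring.
  have [|u ->] := w_regular (f := f); last by exists u, 0; rewrite mulr0 addr0 mulrC.
  by exists a; rewrite fw mulr0 addr0 mulrC.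
have JE' f : J f <-> exists a u, V u /\ f = u + a * w.
  split=> [/JE[a [b ->]]|[b [u [[a [c ->]] ->]]]].
    by exists b, (a * v); split=> //; exists a, 0; rewrite mulr0 addr0.
  by apply/JE; exists a, b; rewrite mulr0 addr0.
have shift (N N' : Sh -> Prop) u e b m :
    graded_subrep N -> graded_subrep N' -> u \is e.-homog -> semi_invariant b u ->
    (forall f, N (f * u) <-> N f) ->
    (forall f, N' f <-> exists a x, N x /\ f = x + a * u) ->
    phi (piece N' m) = phi (piece N m) -
      (if (e <= m)%N then phi (twist (piece N (m - e)) b) else 0).
  move=> NP N'P ue ub reg NN'; case: leqP => em.
    by rewrite (phi_piece_shift NP N'P ue ub reg NN' phiP em) addrC addKr.
  by rewrite subr0 (phi_piece_small NP N'P ue NN' phiP em).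
have twist0 r : phi (twist r false) = phi r.
  by apply: phi_sim; apply: twist_false.
rewrite (shift V J w d' false) //; last exact: graded_J.
rewrite twist0 !(shift (@zero_sub k) V v d true) //; try exact: graded_subrep0.
rewrite -/(A0 n) -/(A0 (n - d')) -!/(A0 _) -subnDA [(d' + d)%N]addnC.
case: (leqP d' n) => d'n.
  have -> : (d <= n - d')%N = (d + d' <= n)%N by apply/idP/idP; lia.
  by rewrite opprD opprK addrA.
have -> : (d + d' <= n)%N = false by apply/negP; lia.
by rewrite addr0.
Qed.

Lemma chi_two_generators :
  K0s_eq (chi J)
    (K0s_mul (chi (@zero_sub k))
      (K0s_add
        (K0s_sub (K0s_sub (K0s_mono (Triv k) 0) (K0s_mono (Sign k) d))
          (K0s_mono (Triv k) d'))
        (K0s_mono (Sign k) (d + d')))).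
Proof.
move=> n A phi phiP; have [phi_sim _] := phiP.
have twist_sign (r : grepr) :
    phi (Representation (prod_repr r (Sign k))) = phi (twist r true).
  by symmetry; apply: phi_sim; apply: twist_prod.
have twist_triv (r : grepr) : phi (Representation (prod_repr r (Triv k))) = phi r.
  have <- : phi (twist r false) = phi r.
    by apply: phi_sim; apply: twist_false.
  by symmetry; apply: phi_sim; apply: twist_prod.
rewrite big_seq1 /= mulr1z phi_piece_J // -/(K0_eval phi _).
rewrite (K0_eval_mul phi _ _ (r := A0)) //.
under eq_bigr do rewrite K0_eval_prodD !K0_eval_prodB.
rewrite big_split /= !sumrB !sum_K0_eval_mono leq0n subn0.
by rewrite !twist_sign !twist_triv.
Qed.

(** The dimension is an additive invariant. *)
Lemma hilb_two_generators n : (hilb J n)%:R =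
  n.+1%:R - (n.+1 - d)%:R - (n.+1 - d')%:R + (n.+1 - (d + d'))%:R :> int.
Proof.
have := @phi_piece_J int (fun r => (rdegree r)%:R) n.
rewrite -/(hilb J n) /= => ->; last first.
  split=> [r1 r2 /mxrank_rsim -> //|m rG U Umod /=].
  by rewrite -natrD mxrank_coker subnKC ?rank_leq_row.
have zE m : rdegree (A0 m) = m.+1 := hilb_zero_sub k m.
by rewrite !zE; do 3!case: leqP => ?; lia.
Qed.

End TwoGenerators.
End Characters.

Lemma coef_geometric_product (a b n : nat) :
  ((\poly_(i < a) 1) * (\poly_(i < b) 1) : {poly int})`_n =
  n.+1%:R - (n.+1 - a)%:R - (n.+1 - b)%:R + (n.+1 - (a + b))%:R.
Proof.
elim: b => [|b IHb].
  have -> : \poly_(i < 0) 1 = 0 :> {poly int} by apply/polyP => i; rewrite coef_poly coef0.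
  by rewrite mulr0 coef0 subn0 addn0; lia.
have -> : \poly_(i < b.+1) 1 = \poly_(i < b) 1 + 'X^b :> {poly int}.
  apply/polyP => i; rewrite coefD !coef_poly coefXn ltnS leq_eqVlt.
  by case: ltngtP.
by rewrite mulrDr coefD IHb coefMXn coef_poly; case: ifP => nb; [|case: ifP => nb']; lia.
Qed.

Lemma geometric_poly (a : nat) :
  (\poly_(i < a) 1) * (1 - 'X) = 1 - 'X^a :> {poly int}.
Proof.
rewrite -[1 in RHS](expr1n _ a) subrXX mulrC; congr (_ * _).
by rewrite poly_def; apply: eq_bigr => i _; rewrite scale1r expr1n mul1r.
Qed.

(** * Maximality *)

Section Homogeneity.
Variable k : fieldType.
Local Notation Sh := {mpoly k[2]}.
Implicit Types (f u v : Sh).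

Lemma mderiv_homog (i : 'I_2) d f : f \is d.+1.-homog -> f^`M(i) \is d.-homog.
Proof.
move=> /dhomogP fd; rewrite [f]mpolyE raddf_sum big_seq; apply: rpred_sum => m /fd mE.
rewrite /= mderivZ mderivX; apply: rpredZ; case: (posnP (m i)) => [->|mi].
  by rewrite scale0r rpred0.
have Um : (U_(i) <= m)%MM by rewrite lep1mP -lt0n.
apply: rpredZ; rewrite dhomogX; apply/eqP/succn_inj; move: mE => /= <-.
by rewrite -{2}(submK Um) mdegD mdeg1 addn1.
Qed.

(** Homogeneity passes to the quotient by the linear form, as multiplication
    by that form shifts the homogeneous components. *)
Lemma divdiff_homog i j d f : i != j -> f \is d.+1.-homog -> divdiff i j f \is d.-homog.
Proof.
move=> ij fd; rewrite homog_piE; apply/eqP/(mulIf (xbar_neq k ij)).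
have xh : xbar k i - xbar k j \is 1.-homog by rewrite rpredB ?xbar_homog.
have := pihomogM d.+1 (divdiff i j f) xh; rewrite /= subSS subn0 => <-.
by rewrite divdiffP pihomog_dE // rpredB // Sh_act_homog.
Qed.

Lemma dunkl_homog c y d f : f \is d.+1.-homog -> dunkl 1 c y f \is d.-homog.
Proof.
move=> fd; rewrite dunkl3E; apply: rpredB.
  by apply: rpredZ; apply: rpred_sum => i _; apply: rpredZ; apply: mderiv_homog.
by do 2?[apply: rpredD]; apply: rpredZ; apply: divdiff_homog.
Qed.

End Homogeneity.

Section Generators.
Variables (k : fieldType) (p m e : nat) (c : k).
Local Notation Sh := {mpoly k[2]}.
Local Notation n := (2 * m).+1.
Local Notation X := ('X_ord0 : Sh).
Local Notation Y := ('X_ord_max : Sh).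
Implicit Types (f u : Sh).
Hypotheses (p_char : p \in [pchar k]) (p_eq : p = (3 * n + 2 * e.+1)%N).
Hypothesis c_eq : 2%:R * c = n%:R.

Let v := qdisc k ^+ n.
Let w := vec_p k e.+1 m.

Lemma natr_neq0 j : (0 < j < p)%N -> j%:R != 0 :> k.
Proof.
case/andP=> j0 jp; rewrite -(dvdn_pcharf p_char).
by apply: contraL jp => /(dvdn_leq j0); rewrite -leqNgt.
Qed.

Lemma two_neq0 : 2%:R != 0 :> k. Proof. by apply: natr_neq0; lia. Qed.
Lemma three_neq0 : 3%:R != 0 :> k. Proof. by apply: natr_neq0; lia. Qed.

Lemma v_semi : semi_invariant true v.
Proof. by have := semi_invariantX n (semi_invariant_qdisc k); rewrite /= oddM. Qed.

Lemma v_homog : v \is (3 * n)%N.-homog.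
Proof. exact: dhomogMn (qdisc_homog k). Qed.

Lemma w_homog : w \is p.-homog.
Proof. by rewrite p_eq; have := vec_p_homog k e.+1 m; congr (_ \is _.-homog); lia. Qed.

Lemma v_neq0 : v != 0. Proof. by rewrite expf_neq0 ?qdisc_neq0. Qed.

Lemma w_regular f : (exists u, f * w = v * u) -> exists u, f = v * u.
Proof.
apply: (qdiscX_dvd_mul two_neq0 three_neq0) => b bw.
apply: (line_res_vec_p_neq0 two_neq0 three_neq0) => // [j jm|].
  by apply: natr_neq0; lia.
have two_expn : (2 ^ m)%:R != 0 :> k by rewrite natrX expf_neq0 ?two_neq0.
rewrite natrM mulf_neq0 // fact_prod natr_prod prodf_seq_neq0.
by apply/allP => i; rewrite mem_index_iota => /andP[i0 im]; apply: natr_neq0; lia.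
Qed.

Lemma dunkl_v y : in_h y -> dunkl 1 c y v = 0.
Proof. by move=> hy; apply: dunkl_qdiscX; rewrite //= oddM. Qed.

Lemma dunkl_w y : in_h y -> exists a, dunkl 1 c y w = a * v.
Proof.
move=> hy; rewrite dunkl_inv; last exact: semi_invariant_vec_p.
pose l := sigma2 k ^+ e * ((y 0 1)%:MP * X - (y 0 0)%:MP * Y).
exists (2%:R^-1 *: l); have two0 : (2%:R : Sh) != 0.
  by rewrite -mpolyC_nat mpolyC_eq0 two_neq0.
apply: (mulfI two0); rewrite deriv_vec_p //.
- rewrite -/v -/l -mul_mpolyC -mulrA [RHS]mulrA -mpolyC_nat -mpolyCM.
  by rewrite divff ?two_neq0 // mpolyC1 mul1r mulrC.
- have -> : (2 * e.+1 + 6 * m + 3 = p)%N by lia.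
  by apply/eqP; rewrite -(dvdn_pcharf p_char).
- by move=> j jm; apply: natr_neq0; lia.
Qed.

Lemma ideal_vw_submodule : submodule (M := verma 1 c) (ideal2 v w).
Proof.
apply: (ideal2_submodule v_semi (semi_invariant_vec_p k e.+1 m)) => y hy.
  by rewrite dunkl_v //; exists 0, 0; rewrite !mul0r addr0.
by have [a ->] := dunkl_w hy; exists a, 0; rewrite mul0r addr0.
Qed.

Local Notation J := (generated_submodule (M := verma 1 c) [:: v; w]).

Lemma J_ideal f : J f <-> ideal2 v w f.
Proof. exact: generated_ideal2 ideal_vw_submodule. Qed.

Lemma J_low d f : f \is d.-homog -> J f -> (d < 3 * n)%N -> f = 0.
Proof.
move=> fd /J_ideal[a [b fE]] dn; rewrite -(pihomog_dE fd) fE linearD /=.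
rewrite (pihomogM _ _ v_homog) (pihomogM _ _ w_homog).
by rewrite !ifF ?mul0r ?addr0 //; apply/negP; lia.
Qed.

(** The Hilbert function vanishes from degree 3 n + p - 1 on. *)
Lemma J_high d f : f \is d.-homog -> (3 * n + p <= d.+1)%N -> J f.
Proof.
move=> fd dn; have JP := graded_J v_semi (semi_invariant_vec_p k e.+1 m) v_homog
  w_homog J_ideal.
have := hilb_two_generators v_semi (semi_invariant_vec_p k e.+1 m) v_homog
  w_homog v_neq0 w_regular J_ideal d.
have [pi [_ pi_ker _]] := graded_pieceP d JP.
move=> hE; have h0 : rdegree (piece J d) = 0%N by rewrite -/(hilb J d); lia.
apply/pi_ker => //; move: (pi f); rewrite h0 => x; exact: thinmx0.
Qed.

Lemma J_proper : ~ J (1 : Sh).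
Proof.
by move=> J1; have /eqP := J_low (dhomog1 _ _) J1 isT; rewrite oner_eq0.
Qed.

Let subJ : submodule (M := verma 1 c) J := generated_submoduleP _.

Lemma c_neq0 : c != 0.
Proof.
apply: contraTneq (natr_neq0 (j := n) _); last by lia.
by move=> c0; rewrite -c_eq c0 mulr0 eqxx.
Qed.

(** The Euler operator leaves only the degrees p, (3 n + p) / 2 and 3 n, below the
    socle degree 3 n + p - 2.  The first two are excluded by the sl_2-action; in
    the last one J has no element of smaller degree, so that the antisymmetric part of f
    is singular in Sh itself. *)
Lemma singular_J d f : (0 < d)%N -> f \is d.-homog ->
  (forall y, in_h y -> J (dunkl 1 c y f)) -> J f.
Proof.
move=> d0 fd f_sing; have [dT|dT] := leqP (3 * n + p) d.+1; first exact: J_high fd dT.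
have c3 : 2%:R * (3%:R * c) = (3 * n)%:R :> k by rewrite mulrCA c_eq -natrM.
have J_shift l : (3 * n + p <= (d + 2 * l).+1)%N -> J (sigma2 k ^+ l * f).
  move=> lT; apply: J_high (lT).
  by rewrite addnC; apply: dhomogM => //; apply: dhomogMn (sigma2_homog k).
have := singular_degree subJ fd f_sing.
have [nz|] := boolP (d%:R * (3%:R * c - d%:R) * (6%:R * c - d%:R) != 0).
  exact: (submodZ_neq0 subJ nz).
move=> + _; rewrite negbK !mulf_eq0 -orbA => /or3P[].
- rewrite -(dvdn_pcharf p_char) => /dvdnP[j dE].
  have dp : d = p by case: j dE => [|[|j]]; lia.
  apply: (singular_descend (l := (3 * m).+1) subJ fd f_sing three_neq0).
    move=> i im; split; first by apply: natr_neq0; lia.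
    rewrite dp; have -> : p%:R = 0 :> k by apply/eqP; rewrite -(dvdn_pcharf p_char).
    rewrite addr0 mulrBr c3 -natrM -opprB oppr_eq0 -natrB; last by lia.
    by apply: natr_neq0; lia.
  by apply: J_shift; lia.
- move=> /eqP cd; have cd2 : (3 * n)%:R = (2 * d)%:R :> k.
    by apply/eqP; rewrite -subr_eq0 -c3 natrM -mulrBr cd mulr0.
  have d2 : (2 * d = 3 * n + p)%N.
    have [le|lt] := leqP (3 * n) (2 * d).
      have : (p %| 2 * d - 3 * n)%N by rewrite (dvdn_pcharf p_char) natrB // cd2 subrr.
      by case/dvdnP => j; case: j => [|[|[|[|j]]]]; lia.
    have : (p %| 3 * n - 2 * d)%N by rewrite (dvdn_pcharf p_char) natrB 1?ltnW // cd2 subrr.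
    by move/dvdn_leq; lia.
  apply: (singular_descend (l := d) subJ fd f_sing three_neq0); last first.
    by apply: J_shift; lia.
  move=> j jd; split; first by apply: natr_neq0; lia.
  by rewrite (subr0_eq cd) subrK mulf_neq0 ?two_neq0 // natr_neq0 //; lia.
- move=> /eqP/subr0_eq cd; have dn : d = (3 * n)%N.
    have cd2 : (3 * n)%:R = d%:R :> k by rewrite -cd -c3; ring.
    have [le|lt] := leqP (3 * n) d.
      have : (p %| d - 3 * n)%N by rewrite (dvdn_pcharf p_char) natrB // cd2 subrr.
      by case/dvdnP => j; case: j => [|j]; lia.
    have : (p %| 3 * n - d)%N by rewrite (dvdn_pcharf p_char) natrB 1?ltnW // cd2 subrr.
    by move/dvdn_leq; lia.
  have Jf := singular_antisym subJ fd f_sing (esym cd) c_neq0.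
  have n18 : 18%:R != 0 :> k.
    have -> : 18%:R = 2%:R * (3%:R * 3%:R) :> k by ring.
    by rewrite !mulf_neq0 ?two_neq0 ?three_neq0.
  have antisym_homog : antisym f \is (3 * n)%N.-homog.
    have hS u : u \is (3 * n)%N.-homog -> refl_sum u \is (3 * n)%N.-homog.
      by move=> uh; do 2?[apply: rpredD]; apply: Sh_act_homog.
    rewrite dn in fd; apply: rpredB; first exact: hS (hS _ fd).
    by apply: rpredZ; apply: hS.
  have D0 y : in_h y -> dunkl 1 c y (antisym f) = 0.
    move=> hy; apply: (J_low (d := (3 * n).-1)); last by rewrite prednK.
      by apply: dunkl_homog; rewrite prednK.
    have := submod_dunkl subJ hy Jf; rewrite addrC -scaleNr dunkl_linear => JD.
    have := submodD subJ JD (submodZ subJ 18%:R (f_sing y hy)).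
    by rewrite scaleNr addrAC addNr add0r.
  have [|y hy|u uE] := qdiscX_dvd_deriv (n := n) (f := antisym f) two_neq0 three_neq0.
  + by move=> j jn; apply: natr_neq0; lia.
  + have := dunkl_anti c hy (semi_invariant_antisym f); rewrite D0 // mulr0.
    by move=> /esym/subr0_eq ->; rewrite c_eq scaler_nat mulr_natl.
  have Ja : J (antisym f) by apply/J_ideal; exists u, 0; rewrite mul0r addr0 uE mulrC.
  apply: (submodZ_neq0 subJ n18); have := submodB subJ Ja Jf.
  by rewrite opprB addrCA subrr addr0.
Qed.

Lemma J_maximal : max_proper_graded_submodule J.
Proof.
have JP := graded_J v_semi (semi_invariant_vec_p k e.+1 m) v_homog w_homog J_ideal.
split; first by split; [exact: subJ | exists (1 : Sh); exact: J_proper | case: JP].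
move=> N' [subN' [f0 Nf0] N'h].
have main d : forall f : Sh, f \is d.-homog -> N' f -> J f.
  elim/ltn_ind: d => -[_|d IHd] f fd Nf; last first.
    apply: (singular_J _ fd) => // y hy; apply: (IHd d) => //.
      exact: dunkl_homog.
    exact: submod_dunkl.
  have fE : f = (f@_0)%:MP.
    apply/mpolyP => mm; rewrite mcoeffC; case: eqVneq => [->|mm0].
      by rewrite mulr1.
    by rewrite mulr0 (dhomog_nemf_coeff fd) //= mdeg_eq0.
  case: (eqVneq f@_0 0) => [f00|f00].
    by rewrite fE f00 mpolyC0; apply: submod0 subJ.
  case: Nf0; rewrite -[f0]mulr1; apply: (submodM subN').
  by apply: (submodZ_neq0 subN' f00); rewrite -mul_mpolyC mulr1 -fE.
move=> f Nf; have -> := @pihomog_partitionE 2 k mdeg _ f (leqnn _).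
elim/big_ind: _ => [|g h Jg Jh|i _]; first exact: submod0 subJ.
  exact: (submodD subJ Jg Jh).
by apply: (main i); [apply: pihomogP | apply: N'h].
Qed.

Lemma J_complete_intersection : complete_intersection (J : Sh -> Prop).
Proof.
exists [:: v; w]; split; last by move=> f; rewrite J_ideal in_ideal2.
split; first by move=> /in_ideal2/J_ideal/J_proper.
case=> [|[|//]] _ f /=.
  move=> /in_ideal0/eqP; rewrite mulf_eq0 (negPf v_neq0) orbF => /eqP ->.
  by apply/in_ideal0.
move=> /in_ideal1[a fw]; apply/in_ideal1.
have [|u ->] := w_regular (f := f); last by exists u; rewrite mulrC.
by exists a; rewrite fw mulrC.
Qed.

Lemma J_character :
  K0s_eq (chi J)
    (K0s_mul (chi (@zero_sub k))
      (K0s_add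
        (K0s_sub (K0s_sub (K0s_mono (Triv k) 0) (K0s_mono (Sign k) (3 * n)))
          (K0s_mono (Triv k) p))
        (K0s_mono (Sign k) (3 * n + p)))).
Proof.
exact: (chi_two_generators v_semi (semi_invariant_vec_p k e.+1 m) v_homog w_homog
  v_neq0 w_regular J_ideal).
Qed.

Lemma J_hilbert : exists2 h : {poly int}, forall d, h`_d = (hilb J d)%:R &
  tofrac h = tofrac ((1 - 'X^(3 * n)) * (1 - 'X^p)) / tofrac ((1 - 'X) ^+ 2).
Proof.
exists ((\poly_(i < 3 * n) 1) * (\poly_(i < p) 1)) => [d|].
  rewrite coef_geometric_product (hilb_two_generators v_semi
    (semi_invariant_vec_p k e.+1 m) v_homog w_homog v_neq0 w_regular J_ideal) //.
rewrite -!geometric_poly [_ * _ * (_ * _)]mulrACA -expr2.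
move: (_ * \poly_(i < p) 1) => h; rewrite rmorphM mulfK //.
rewrite tofrac_eq0 expf_neq0 // -oppr_eq0 opprB polyXsubC_eq0 //.
Qed.

End Generators.

Theorem theorem7p4 (k : closedFieldType) (p : nat) (c : 'F_p)
    (p_char : p \in [pchar k]) (p_gt3 : (3 < p)%N)
    (c_gt : (p < 2 * c)%N) (c_lt : (3 * c < 2 * p)%N) :
  let m := (c - p.+1 %/ 2)%N in
  let v1 : {mpoly k[2]} := qdisc k ^+ (2 * c - p) in
  let v2 : {mpoly k[2]} :=
    sigma2 k ^+ (2 * p - 3 * c) * sigma3 k *
    \sum_(0 <= j < m.+1)
      ('C(m, j)%:R / (2 * j + 1)%:R) *:
        (((- 4%:R) *: sigma2 k ^+ 3) ^+ (m - j) *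
         ((- 27%:R) *: sigma3 k ^+ 2) ^+ j) in
  let J := generated_submodule (M := verma 1 (c%:R : k)) [:: v1; v2] in
  [/\ v1 = ((- 4%:R) *: sigma2 k ^+ 3 - 27%:R *: sigma3 k ^+ 2) ^+ m * qdisc k,
      max_proper_graded_submodule J,
      complete_intersection (J : {mpoly k[2]} -> Prop),
      K0s_eq (chi J)
        (K0s_mul (chi (@zero_sub k))
          (K0s_add
            (K0s_sub
              (K0s_sub (K0s_mono (Triv k) 0) (K0s_mono (Sign k) (6 * c - 3 * p)))
              (K0s_mono (Triv k) p))
            (K0s_mono (Sign k) (6 * c - 2 * p)))) &
      exists2 h : {poly int},
        forall d, h`_d = (hilb J d)%:R &
        tofrac h =
        tofrac ((1 - 'X^(6 * c - 3 * p)) * (1 - 'X^p)) / tofrac ((1 - 'X) ^+ 2)].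
Proof.
have p_odd : odd p.
  by have := even_prime (pcharf_prime p_char); case=> // p2; rewrite p2 in p_gt3.
move=> m v1 v2; move: (nat_of_ord c) c_gt c_lt @m @v1 @v2 => a a_gt a_lt m v1 v2 J.
have p2 : p = ((p./2).*2).+1 by rewrite -[LHS]odd_double_half p_odd.
have mE : m = (a - (p./2).+1)%N.
  by rewrite /m p2 -doubleS -muln2 mulnK //= uphalf_double.
clearbody m; have [e eE] : exists e, (2 * p - 3 * a = e.+1)%N.
  by exists (2 * p - 3 * a).-1; rewrite prednK // subn_gt0.
have nE : (2 * a - p = (2 * m).+1)%N by lia.
have p_eq : p = (3 * (2 * m).+1 + 2 * e.+1)%N by lia.
have c_eq : 2%:R * a%:R = (2 * m).+1%:R :> k.
  have -> : 2%:R * a%:R = ((2 * m).+1 + p)%:R :> k.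
    have <- : (2 * a = (2 * m).+1 + p)%N by lia.
    by rewrite natrM.
  by rewrite natrD (pcharf0 p_char) addr0.
have v1E : v1 = qdisc k ^+ (2 * m).+1 by rewrite /v1 nE.
have v2E : v2 = vec_p k e.+1 m by rewrite /v2 eE.
have -> : (6 * a - 3 * p = 3 * (2 * m).+1)%N by lia.
have -> : (6 * a - 2 * p = 3 * (2 * m).+1 + p)%N by lia.
rewrite /J v2E v1E; clear J v1 v2 v1E v2E; split.
- by rewrite exprS exprM qdisc_sqr -scaleNr mulrC.
- exact: (J_maximal p_char p_eq c_eq).
- exact: (J_complete_intersection p_char p_eq c_eq).
- exact: (J_character p_char p_eq c_eq).
- exact: (J_hilbert p_char p_eq c_eq).
Qed.
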